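(* Let $f_1,\dots,f_n:\mathbb{R}^d\to\mathbb{R}$ and $0<\mu_f\le L_f$ be such that each $f_i$ is of class $C^2$, $\mu_f$-strongly convex and has an $L_f$-Lipschitz continuous gradient. Let $f=\frac1n\sum_{i=1}^n f_i$ and $w^*=\mathrm{argmin}\,f$. Let $x^k=[w^k;\alpha_1^k;\dots;\alpha_n^k]$, $k\in\mathbb{N}$, be a sequence generated either by the SAN algorithm with probability $\pi=1/(n+1)$ or by the SANA algorithm (see context), with step size $\gamma$, and let $\hat f_k$ be the associated surrogate functions (see context). Assume that there exists $L>0$ such that, for every $k\in\mathbb{N}$ and every $x\in\mathbb{R}^{(n+1)d}$, $$\hat f_{k+1}(x)\le\hat f_k(x^k)+\langle\nabla\hat f_k(x^k),x-x^k\rangle+\tfrac L2\|x-x^k\|^2_{\mathbf{W}_k},$$ and that $\gamma=1/L$. Then for every $k\in\mathbb{N}$, $$\mathbb{E}\left[\|w^k-w^*\|^2\right]+\sum_{i=1}^n\mathbb{E}\left[\|\alpha_i^k-\nabla f_i(w^* )\|^2\right]\le C(1-\gamma\rho)^k,$$ where one can take $$\rho=\frac{\min\{1,\mu_f^3\}}{14n^3(2+L_f^2)^2\max\{1,L_f^3\}},\qquad C=18n^2\,\frac{\max\{1,L_f^2\}(2+L_f^2)^2}{\min\{1,\mu_f^3\}}\,\mathbb{E}[\hat f_0(x^0)].$$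
   Context: Notation: $p=(n+1)d$, $x=[w;\alpha_1;\dots;\alpha_n]\in\mathbb{R}^p$ with $w,\alpha_i\in\mathbb{R}^d$, and $$F(x)=\left[\tfrac1n\textstyle\sum_{i}\alpha_i;\ \nabla f_1(w)-\alpha_1;\dots;\nabla f_n(w)-\alpha_n\right]\in\mathbb{R}^p.$$ $\nabla F(x)\in\mathbb{R}^{p\times p}$ is the transpose of the usual Jacobian, $^\dagger$ is the Moore–Penrose pseudoinverse, and $\|v\|_{\mathbf{M}}^2=\langle\mathbf{M}v,v\rangle$. SAN with probability $\pi\in(0,1)$ and step size $\gamma\in(0,1]$: start from deterministic $w^0,\alpha^0_1,\dots,\alpha^0_n\in\mathbb{R}^d$. At each iteration $k$, with fresh independent randomness: - with probability $\pi$: $\alpha_i^{k+1}=\alpha_i^k-\frac\gamma n\sum_{j=1}^n\alpha_j^k$ for all $i$, and $w^{k+1}=w^k$; in this case set $\mathbf{W}_k=\mathbf{I}_{p}$; - otherwise (with probability $1-\pi$): sample $j\in\{1,\dots,n\}$ uniformly, set $d^k=-(\mathbf{I}_d+\nabla^2f_j(w^k))^{-1}(\nabla f_j(w^k)-\alpha_j^k)$, $w^{k+1}=w^k+\gamma d^k$, $\alpha_j^{k+1}=\alpha_j^k-\gamma d^k$, $\alpha_i^{k+1}=\alpha_i^k$ for $i\ne j$; in this case set $\mathbf{W}_k=\mathrm{Diag}(\nabla^2f_j(w^k),\mathbf{I}_d,\dots,\mathbf{I}_d)$ (block diagonal). SANA with step size $\gamma\in(0,1]$: start from deterministic $w^0,\alpha_1^0,\dots,\alpha_n^0$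 with $\sum_i\alpha_i^0=0$. At each iteration $k$, sample $j\in\{1,\dots,n\}$ uniformly (independently of the past), set $d^k=-((1-\frac1n)\mathbf{I}_d+\nabla^2f_j(w^k))^{-1}(\nabla f_j(w^k)-\alpha_j^k)$, $w^{k+1}=w^k+\gamma d^k$, $\alpha_j^{k+1}=\alpha_j^k-\gamma(1-\frac1n)d^k$, $\alpha_i^{k+1}=\alpha_i^k+\frac\gamma n d^k$ for $i\neq j$; set $\mathbf{W}_k=\mathrm{Diag}(\nabla^2f_j(w^k),\mathbf{I}_d,\dots,\mathbf{I}_d)$. Surrogate functions: $\hat f_k(x)=\frac12\|F(x)\|^2_{(\nabla F(x^k)^\top\mathbf{W}_k^{-1}\nabla F(x^k))^\dagger}$, where $x^k,\mathbf{W}_k$ are held fixed as $x$ varies. The assumption on $L$ is required for every realization of the random choices of the run. *)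

(* Defs.v *)
From HB Require Import structures.
From mathcomp Require Import all_boot all_order all_algebra.
From mathcomp Require Import all_classical all_reals all_analysis.

Set Implicit Arguments.
Unset Strict Implicit.
Unset Printing Implicit Defensive.

Import Order.TTheory GRing.Theory Num.Theory.
Import numFieldNormedType.Exports.

Local Open Scope classical_set_scope.
Local Open Scope ring_scope.

(* The library norm on matrices is the sup norm, which induces the right
   topology but is not the Euclidean norm; hence the definitions below. *)
Definition dot (R : realType) (m : nat) (u v : 'cV[R]_m) : R :=
  \sum_i u i 0 * v i 0.

Definition enorm (R : realType) (m : nat) (v : 'cV[R]_m) : R :=
  Num.sqrt (dot v v).

Definition sqnormM (R : realType) (m : nat) (M : 'M[R]_m) (v : 'cV[R]_m) : R :=
  dot (M *m v) v.

Definition is_pinv (R : realType) (m n : nat)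
    (A : 'M[R]_(m, n)) (B : 'M[R]_(n, m)) : Prop :=
  [/\ A *m B *m A = A, B *m A *m B = B,
      (A *m B)^T = A *m B & (B *m A)^T = B *m A].

(* Moore-Penrose pseudoinverse; mathcomp's pinvmx is only a partial inverse on
   a row space. Existence and uniqueness are pinvP and is_pinv_uniq. *)
Definition pinv (R : realType) (m n : nat) (A : 'M[R]_(m, n)) : 'M[R]_(n, m) :=
  xget 0 [set B | is_pinv A B].

Lemma is_pinv_uniq (R : realType) (m n : nat)
    (A : 'M[R]_(m, n)) (B C : 'M[R]_(n, m)) :
  is_pinv A B -> is_pinv A C -> B = C.
Proof.
move=> [b1 b2 b3 b4] [c1 c2 c3 c4].
have eAB : A *m B = A *m C.
  by rewrite -b3 -[in LHS]c1 -(mulmxA (A *m C)) trmx_mul b3 c3 mulmxA b1.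
have eBA : B *m A = C *m A.
  by rewrite -b4 -[in LHS]c1 -mulmxA mulmxA trmx_mul c4 b4 -mulmxA (mulmxA A) b1.
by rewrite -b2 eBA -mulmxA eAB mulmxA c2.
Qed.

Lemma row_free_gram_unit (R : realType) (m n : nat) (A : 'M[R]_(m, n)) :
  row_free A -> A *m A^T \in unitmx.
Proof.
move=> fA; rewrite -row_free_unit -kermx_eq0; apply/rowV0P => v /sub_kermxP v0.
suff vA0 : v *m A = 0 by apply/(row_free_inj fA); rewrite vA0 mul0mx.
have : (v *m A *m (v *m A)^T) 0 0 = 0.
  by rewrite trmx_mul mulmxA -(mulmxA v) v0 mul0mx mxE.
rewrite mxE => /eqP; rewrite psumr_eq0; last first.
  by move=> i _; rewrite [X in _ * X]mxE -expr2 sqr_ge0.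
move=> /allP h; apply/matrixP => i j; rewrite ord1 [RHS]mxE; apply/eqP.
by have := h j (mem_index_enum j); rewrite [X in _ * X]mxE mulf_eq0 orbb.
Qed.

Lemma pinvP (R : realType) (m n : nat) (A : 'M[R]_(m, n)) :
  is_pinv A (pinv A).
Proof.
rewrite /pinv; case: xgetP => [B -> //|/= nA]; exfalso.
have [r [C [D [eA uD uC]]]] : exists r (C : 'M[R]_(m, r)) (D : 'M[R]_(r, n)),
    [/\ A = C *m D, D *m D^T \in unitmx & C^T *m C \in unitmx].
  exists (\rank A), (col_base A), (row_base A); split.
  - by rewrite mulmx_base.
  - exact/row_free_gram_unit/row_base_free.
  - rewrite -[X in _ *m X]trmxK; apply: row_free_gram_unit.
    by rewrite /row_free mxrank_tr; exact: col_base_full.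
pose Di := D^T *m invmx (D *m D^T); pose Ci := invmx (C^T *m C) *m C^T.
have DDi : D *m Di = 1%:M by rewrite mulmxA mulmxV.
have CiC : Ci *m C = 1%:M by rewrite -mulmxA mulVmx.
apply: (nA (Di *m Ci)).
have eAB : A *m (Di *m Ci) = C *m Ci by rewrite eA mulmxA -(mulmxA C) DDi mulmx1.
have eBA : Di *m Ci *m A = Di *m D by rewrite eA mulmxA -(mulmxA Di) CiC mulmx1.
split.
- by rewrite eAB eA mulmxA -(mulmxA C) CiC mulmx1.
- by rewrite eBA mulmxA -(mulmxA Di) DDi mulmx1.
- by rewrite eAB /Ci !trmx_mul trmx_inv !trmx_mul !trmxK mulmxA.
- by rewrite eBA /Di !trmx_mul trmx_inv !trmx_mul !trmxK mulmxA.
Qed.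

(* Transpose of the usual Jacobian: entry (i, j) is the i-th partial derivative
   of the j-th component. *)
Definition nabla (R : realType) (m q : nat)
    (G : 'cV[R]_m -> 'cV[R]_q) (x : 'cV[R]_m) : 'M[R]_(m, q) :=
  \matrix_(i, j) ('D_(delta_mx i 0) G x) j 0.

Definition grad (R : realType) (m : nat)
    (g : 'cV[R]_m -> R) (x : 'cV[R]_m) : 'cV[R]_m :=
  \col_i 'D_(delta_mx i 0) g x.

Definition hess (R : realType) (m : nat)
    (g : 'cV[R]_m -> R) (x : 'cV[R]_m) : 'M[R]_m :=
  nabla (grad g) x.

Definition class_C2 (R : realType) (m : nat) (g : 'cV[R]_m -> R) : Prop :=
  [/\ forall x, differentiable g x,
      forall x, differentiable (grad g) x &
      continuous (hess g)].

Definition strongly_convex (R : realType) (m : nat) (mu : R)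
    (g : 'cV[R]_m -> R) : Prop :=
  forall (x y : 'cV[R]_m) (t : R), 0 <= t <= 1 ->
    g (t *: x + (1 - t) *: y) <=
      t * g x + (1 - t) * g y - mu / 2 * t * (1 - t) * enorm (x - y) ^+ 2.

Definition lipschitz_grad (R : realType) (m : nat) (Lf : R)
    (g : 'cV[R]_m -> R) : Prop :=
  forall x y : 'cV[R]_m, enorm (grad g x - grad g y) <= Lf * enorm (x - y).

(* R^p with p = (n+1)d is 'cV_(\sum_(i < n.+1) d), so that mathcomp's block
   operations apply: block 0 is w and block i+1 is alpha_i. *)
Notation pt R n d := 'cV[R]_(\sum_(i < n.+1) d) (only parsing).
Notation ptmx R n d := 'M[R]_(\sum_(i < n.+1) d) (only parsing).

Definition stack (R : realType) (n d : nat)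
    (w : 'cV[R]_d) (a : 'I_n -> 'cV[R]_d) : pt R n d :=
  \mxcol_(i < n.+1) (if unlift ord0 i is Some j then a j else w).

Definition wpart (R : realType) (n d : nat) (x : pt R n d) : 'cV[R]_d :=
  submxcol x ord0.

Definition apart (R : realType) (n d : nat) (x : pt R n d) (i : 'I_n) :
    'cV[R]_d :=
  submxcol x (lift ord0 i).

Definition Fmap (R : realType) (n d : nat) (f : 'I_n -> 'cV[R]_d -> R)
    (x : pt R n d) : pt R n d :=
  stack (n%:R^-1 *: \sum_i apart x i)
        (fun i => grad (f i) (wpart x) - apart x i).

Definition surrogate (R : realType) (n d : nat) (f : 'I_n -> 'cV[R]_d -> R)
    (xk : pt R n d) (Wk : ptmx R n d) (x : pt R n d) : R :=
  2^-1 * sqnormM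
    (pinv ((nabla (Fmap f) xk)^T *m invmx Wk *m nabla (Fmap f) xk)) (Fmap f x).

Definition Wnewton (R : realType) (n d : nat) (f : 'I_n -> 'cV[R]_d -> R)
    (x : pt R n d) (j : 'I_n) : ptmx R n d :=
  \mxdiag_(i < n.+1) (if i == ord0 then hess (f j) (wpart x) else 1%:M).

(* None is the averaging step, Some j the Newton step on f_j. *)
Definition SAN_step (R : realType) (n d : nat) (f : 'I_n -> 'cV[R]_d -> R)
    (gamma : R) (x : pt R n d) (c : option 'I_n) : pt R n d :=
  let w := wpart x in
  let a := apart x in
  match c with
  | None => stack w (fun i => a i - (gamma / n%:R) *: \sum_j a j)
  | Some j =>
      let dk := - (invmx (1%:M + hess (f j) w) *m (grad (f j) w - a j)) in
      stack (w + gamma *: dk)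
            (fun i => if i == j then a i - gamma *: dk else a i)
  end.

Definition SAN_W (R : realType) (n d : nat) (f : 'I_n -> 'cV[R]_d -> R)
    (x : pt R n d) (c : option 'I_n) : ptmx R n d :=
  if c is Some j then Wnewton f x j else 1%:M.

Definition SANA_step (R : realType) (n d : nat) (f : 'I_n -> 'cV[R]_d -> R)
    (gamma : R) (x : pt R n d) (j : 'I_n) : pt R n d :=
  let w := wpart x in
  let a := apart x in
  let dk := - (invmx ((1 - n%:R^-1)%:M + hess (f j) w)
               *m (grad (f j) w - a j)) in
  stack (w + gamma *: dk)
        (fun i => if i == j then a i - (gamma * (1 - n%:R^-1)) *: dk
                  else a i + (gamma / n%:R) *: dk).

Definition iid_choices (R : realType) (disp : measure_display)
    (T : measurableType disp) (P : probability T R)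
    (I : finType) (law : I -> R) (xi : nat -> T -> I) : Prop :=
  [/\ forall k (A : set I), measurable (xi k @^-1` A),
      forall k (c : I), P (xi k @^-1` [set c]) = (law c)%:E &
      forall (J : seq nat) (A : nat -> set I), uniq J ->
        P (\bigcap_(k in [set` J]) (xi k @^-1` A k)) =
          (\prod_(k <- J) P (xi k @^-1` A k))%E].

Definition SAN_law (R : realType) (n : nat) (pr : R) (c : option 'I_n) : R :=
  if c is Some _ then (1 - pr) / n%:R else pr.

Definition generated_by_SAN (R : realType) (disp : measure_display)
    (T : measurableType disp) (P : probability T R) (n d : nat)
    (f : 'I_n -> 'cV[R]_d -> R) (pr gamma : R)
    (x : nat -> T -> pt R n d) (W : nat -> T -> ptmx R n d) : Prop :=
  exists (x0 : pt R n d) (xi : nat -> T -> option 'I_n),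
    [/\ iid_choices P (SAN_law pr) xi,
        forall o, x 0%N o = x0,
        forall k o, x k.+1 o = SAN_step f gamma (x k o) (xi k o) &
        forall k o, W k o = SAN_W f (x k o) (xi k o)].

Definition generated_by_SANA (R : realType) (disp : measure_display)
    (T : measurableType disp) (P : probability T R) (n d : nat)
    (f : 'I_n -> 'cV[R]_d -> R) (gamma : R)
    (x : nat -> T -> pt R n d) (W : nat -> T -> ptmx R n d) : Prop :=
  exists (x0 : pt R n d) (xi : nat -> T -> 'I_n),
    [/\ \sum_i apart x0 i = 0,
        iid_choices P (fun=> n%:R^-1) xi,
        forall o, x 0%N o = x0,
        forall k o, x k.+1 o = SANA_step f gamma (x k o) (xi k o) &
        forall k o, W k o = Wnewton f (x k o) (xi k o)].

(* Main.v *)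
Require Import Defs.
From HB Require Import structures.
From mathcomp Require Import all_boot all_order all_algebra.
From mathcomp Require Import all_classical all_reals all_analysis.
From mathcomp Require Import measurable_realfun ring lra.

(* Let J be the Jacobian of F at x^k.  It is invertible by strong convexity, so
   the pseudoinverse in the surrogate is J^-T W_k J^-1 and, with N = J^-1 F(x^k),
   f_k(x^k) = |N|_{W_k}^2 / 2 and grad f_k(x^k) = W_k N.  Symmetry of the Hessians
   (Schwarz) is used here.  Both algorithms move by - gamma times a W_k-orthogonal
   projection Pi N of N, so the assumed bound at y = x^{k+1} with gamma = 1 / L
   gives f_{k+1}(x^{k+1}) <= f_k(x^k) - (gamma / 2) |Pi N|_{W_k}^2.

   Write N = (N_0; N_1, ..., N_n), r_i = grad f_i(w) - alpha_i and H_i for the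
   Hessians.  Then N_i = H_i N_0 - r_i, and the mean of the H_i N_0 is the mean of
   the alpha_i plus the mean of the r_i; so N is controlled by these two means and
   the r_i, that is, by the conditional expectation of |Pi N|_{W_k}^2.  This is
   the contraction factor 1 - gamma rho.  Conversely mu |w - w^*| <= |grad f(w)|
   and grad f(w) is the mean of the H_i N_0, which bounds the error by the
   conditional expectation of f_k(x^k).

   The choices live in a finite set, so expectations are finite sums over words. *)

Set Implicit Arguments.
Unset Strict Implicit.
Unset Printing Implicit Defensive.

Import Order.TTheory GRing.Theory Num.Theory.
Import numFieldNormedType.Exports.

Local Open Scope classical_set_scope.
Local Open Scope ring_scope.

(** * Euclidean inner product *)

Section Dot.
Context {R : realType} {m : nat}.
Implicit Types (u v w : 'cV[R]_m) (c : R).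

Lemma dotE u v : dot u v = (u^T *m v) 0 0.
Proof. by rewrite mxE; apply: eq_bigr => i _; rewrite mxE. Qed.

Lemma dotC u v : dot u v = dot v u.
Proof. by apply: eq_bigr => i _; rewrite mulrC. Qed.

Lemma dotDl u v w : dot (u + v) w = dot u w + dot v w.
Proof. by rewrite !dotE linearD mulmxDl mxE. Qed.

Lemma dotZl c u v : dot (c *: u) v = c * dot u v.
Proof. by rewrite !dotE linearZ -scalemxAl mxE. Qed.

Lemma dotDr u v w : dot w (u + v) = dot w u + dot w v.
Proof. by rewrite dotC dotDl !(dotC w). Qed.

Lemma dotZr c u v : dot u (c *: v) = c * dot u v.
Proof. by rewrite dotC dotZl dotC. Qed.

Lemma dotNl u v : dot (- u) v = - dot u v.
Proof. by rewrite -scaleN1r dotZl mulN1r. Qed.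

Lemma dotNr u v : dot u (- v) = - dot u v.
Proof. by rewrite dotC dotNl dotC. Qed.

Lemma dotBl u v w : dot (u - v) w = dot u w - dot v w.
Proof. by rewrite dotDl dotNl. Qed.

Lemma dotBr u v w : dot w (u - v) = dot w u - dot w v.
Proof. by rewrite dotDr dotNr. Qed.

Lemma dot0l u : dot 0 u = 0.
Proof. by rewrite dotE linear0 mul0mx mxE. Qed.

Lemma dot0r u : dot u 0 = 0.
Proof. by rewrite dotC dot0l. Qed.

Lemma dot_suml (I : finType) (F : I -> 'cV[R]_m) v :
  dot (\sum_i F i) v = \sum_i dot (F i) v.
Proof.
exact: (big_morph (fun u => dot u v) (fun x y => dotDl x y v) (dot0l v)).
Qed.

Lemma dot_ge0 u : 0 <= dot u u.
Proof. by apply: sumr_ge0 => i _; rewrite -expr2 sqr_ge0. Qed.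

Lemma dot_eq0 u : dot u u = 0 -> u = 0.
Proof.
move=> /eqP; rewrite psumr_eq0; last by move=> i _; rewrite -expr2 sqr_ge0.
move=> /allP h; apply/matrixP => i j; rewrite ord1 mxE; apply/eqP.
by have := h i (mem_index_enum i); rewrite mulf_eq0 orbb.
Qed.

Lemma enorm_sqr u : enorm u ^+ 2 = dot u u.
Proof. by rewrite sqr_sqrtr ?dot_ge0. Qed.

Lemma col_sum_delta u : u = \sum_i u i 0 *: delta_mx i 0.
Proof.
by rewrite {1}(matrix_sum_delta u); apply: eq_bigr => i _; rewrite big_ord1.
Qed.

Lemma dot_sqrD_le u v : dot (u + v) (u + v) <= 2 * dot u u + 2 * dot v v.
Proof.
have := dot_ge0 (u - v); rewrite !(dotBl, dotBr, dotDl, dotDr) (dotC v u); lra.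
Qed.

Lemma dot_sqrB_le u v : dot (u - v) (u - v) <= 2 * dot u u + 2 * dot v v.
Proof. by have := dot_sqrD_le u (- v); rewrite dotNl dotNr opprK. Qed.

(** Jensen's inequality in variance form: with [a] the mean, the sum of the
    [dot (r i - a) (r i - a)] is nonnegative. *)
Lemma dot_mean_le (n : nat) (r : 'I_n -> 'cV[R]_m) : (0 < n)%N ->
  n%:R * dot (n%:R^-1 *: \sum_i r i) (n%:R^-1 *: \sum_i r i)
    <= \sum_i dot (r i) (r i).
Proof.
move=> n0; pose a : 'cV[R]_m := n%:R^-1 *: \sum_i r i; rewrite -/a.
have nn : n%:R != 0 :> R by rewrite pnatr_eq0 -lt0n.
have sa : \sum_i r i = n%:R *: a by rewrite scalerA divff // scale1r.
have : 0 <= \sum_i dot (r i - a) (r i - a).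
  by apply: sumr_ge0 => i _; exact: dot_ge0.
clearbody a; under eq_bigr do rewrite dotBl !dotBr (dotC a).
have sC : \sum_(i < n) dot a a = n%:R * dot a a.
  by rewrite sumr_const card_ord mulr_natl.
by rewrite !sumrB sC -!dot_suml sa dotZl; lra.
Qed.

(** This lemma and the next replace Cauchy-Schwarz without square roots; both expand the square of
    [v - c *: u]. *)
Lemma coercive_dot_sqr c u v : 0 <= c -> c * dot u u <= dot v u ->
  c ^+ 2 * dot u u <= dot v v.
Proof.
move=> c0 h; have := dot_ge0 (v - c *: u).
rewrite !(dotBl, dotBr, dotZl, dotZr) (dotC u v) => h2.
by have := ler_wpM2l c0 h; lra.
Qed.

Lemma dot_le_of_sqr_le c u v : 0 < c -> dot v v <= c ^+ 2 * dot u u ->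
  dot v u <= c * dot u u.
Proof.
move=> c0 h; have := dot_ge0 (v - c *: u).
rewrite !(dotBl, dotBr, dotZl, dotZr) (dotC u v) => h2.
rewrite -(ler_pM2l c0); lra.
Qed.

End Dot.

Lemma dot_mulmxl (R : realType) (m p : nat) (A : 'M[R]_(m, p)) (u : 'cV[R]_p)
    (v : 'cV[R]_m) :
  dot (A *m u) v = dot u (A^T *m v).
Proof. by rewrite !dotE trmx_mul mulmxA. Qed.

(** * Directional derivatives of vector functions *)

Section FiniteDimensionalDerivatives.
Context {R : realType} {m : nat}.
Local Notation V := 'cV[R]_m.

Lemma differentiable_linear_col (W : normedModType R) (h : {linear V -> W})
    (x : V) : differentiable h x.
Proof.
have -> : (h : V -> W) = \sum_i (fun y : V => y i 0 *: h (delta_mx i 0)).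
  apply/funext => y; rewrite {1}(col_sum_delta y) linear_sum fct_sumE.
  by apply: eq_bigr => i _; rewrite linearZ.
apply: differentiable_sum => i; apply: differentiableZl.
exact: differentiable_coord.
Qed.

Lemma linear_col_continuous (W : normedModType R) (h : {linear V -> W}) :
  continuous h.
Proof. by move=> x; apply/differentiable_continuous/differentiable_linear_col. Qed.

Lemma derive_col (W : normedModType R) (G : V -> W) (x v : V) :
  differentiable G x ->
  'D_v G x = \sum_i v i 0 *: 'D_(delta_mx i 0) G x.
Proof.
move=> dG; rewrite deriveE // {1}(col_sum_delta v) linear_sum.
by apply: eq_bigr => i _; rewrite linearZ deriveE.
Qed.

Lemma derive_grad (g : V -> R) (x v : V) :
  differentiable g x -> 'D_v g x = dot (grad g x) v.
Proof.
by move=> dg; rewrite derive_col //; apply: eq_bigr => i _; rewrite mxE mulrC.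
Qed.

Lemma derive_nabla q (G : V -> 'cV[R]_q) (x v : V) :
  differentiable G x -> 'D_v G x = (nabla G x)^T *m v.
Proof.
move=> dG; rewrite derive_col //; apply/matrixP => i j; rewrite ord1 summxE mxE.
by apply: eq_bigr => k _; rewrite !mxE mulrC.
Qed.

Lemma differentiable_col (V' : normedModType R) (G : V' -> V) (x : V') :
  (forall i, differentiable (fun y => G y i 0) x) -> differentiable G x.
Proof.
move=> dG.
have -> : G = \sum_i (fun y => G y i 0 *: delta_mx i 0).
  by apply/funext => y; rewrite {1}(col_sum_delta (G y)) fct_sumE.
by apply: differentiable_sum => i; exact/differentiableZl/dG.
Qed.

Lemma is_derive_coord (V' : normedModType R) (G : V' -> V) (x v : V') dG i :
  is_derive x v G dG -> is_derive x v (fun y => G y i 0) (dG i 0).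
Proof.
move=> [d1 <-]; apply: DeriveDef; first exact: (derivable_mxP _ _ _).1.
by rewrite derive_mx // mxE.
Qed.

Lemma is_derive_dot (V' : normedModType R) (G H : V' -> V) (x v : V') dG dH :
  is_derive x v G dG -> is_derive x v H dH ->
  is_derive x v (fun y => dot (G y) (H y)) (dot dG (H x) + dot (G x) dH).
Proof.
move=> hG hH.
have -> : (fun y => dot (G y) (H y)) =
    \sum_(i < m) ((fun y => G y i 0) * (fun y => H y i 0)).
  by apply/funext => y; rewrite fct_sumE.
apply: is_derive_eq.
  apply: is_derive_sum => i; apply: is_deriveM; exact: is_derive_coord.
rewrite /dot -big_split /=; apply: eq_bigr => i _; rewrite addrC; congr (_ + _).
by rewrite [LHS]mulrC.
Qed.

Lemma continuous_dot_sqr : continuous (fun u : V => dot u u).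
Proof.
move=> u; apply: differentiable_continuous.
have -> : (fun u : V => dot u u) =
    \sum_(i < m) ((fun y : V => y i 0) * (fun y : V => y i 0)).
  by apply/funext => y; rewrite fct_sumE.
apply: differentiable_sum => i.
by apply: differentiableM; exact: differentiable_coord.
Qed.

Lemma continuous_dotl (v : V) : continuous (fun u : V => dot u v).
Proof.
move=> u; apply: differentiable_continuous.
have -> : (fun u : V => dot u v) =
    \sum_(i < m) (fun y : V => y i 0 *: v i 0).
  by apply/funext => y; rewrite fct_sumE.
apply: differentiable_sum => i.
by apply: differentiableZl; exact: differentiable_coord.
Qed.

End FiniteDimensionalDerivatives.

(** * Symmetry and bounds of Hessians *)

Lemma differentiable_remainder (R : realType) (V W : normedModType R)
    (p : V -> W) (x : V) (e : R) : 0 < e -> differentiable p x ->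
  exists2 r : R, 0 < r & forall h, `|h| < r ->
    `|p (x + h) - p x - 'd p x h| <= e * `|h|.
Proof.
move=> e0 /diff_locally /eqaddoP /(_ e e0).
rewrite near_simpl => /nbhs_norm0P [r /= r0 hr]; exists r => // h hh.
have := hr h hh; rewrite /= opprD -![(_ + _ : _ -> _) _]/(_ + _).
by rewrite -![(- _ : _ -> _) _]/(- _) /cst /= addrA (addrC x).
Qed.

Lemma is_derive_line (R : realType) (V W : normedModType R) (g : V -> W)
    (y u : V) (s : R) dg :
  is_derive (y + s *: u) u g dg -> is_derive s 1 (fun t : R => g (y + t *: u)) dg.
Proof.
have E : (fun h : R => h^-1 *: (((fun t : R => g (y + t *: u)) \o shift s) (h *: 1)
             - g (y + s *: u)))
       = (fun h : R =>
            h^-1 *: ((g \o shift (y + s *: u)) (h *: u) - g (y + s *: u))).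
  apply/funext => h /=; do 3 congr (_ _); rewrite [h *: 1]mulr1 scalerDl.
  by rewrite addrCA.
by move=> [d1 d2]; apply: DeriveDef; rewrite ?/derivable ?/derive E.
Qed.

(* The mean value theorem along u reduces the second difference to first
   differences of the partial derivative p along u. *)
Lemma second_difference (R : realType) (V : normedModType R) (g p : V -> R)
    (x u v : V) (e : R) : 0 < e ->
  (forall y, is_derive y u g (p y)) -> differentiable p x ->
  exists2 r : R, 0 < r & forall t, 0 < t < r ->
    `|g (x + t *: u + t *: v) - g (x + t *: u) - g (x + t *: v) + g x
      - t ^+ 2 * 'd p x v| <= e * t ^+ 2.
Proof.
(* The two remainders below are at most [e / M] times [t * |u|] and [t * (|u| + |v|)]; since [M]
   exceeds [2|u| + |v|], their sum stays below [e * t]. The extra 1 keeps [M] positive. *)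
move=> e0 dg dp; pose M := 2 * `|u| + `|v| + 1.
have M0 : 0 < M by rewrite ltr_wpDl // addr_ge0 // mulr_ge0.
have [r r0 hr] := differentiable_remainder (divr_gt0 e0 M0) dp.
exists (r / M); first exact: divr_gt0.
move=> t /andP[t0 tr].
pose phi (s : R) := g (x + t *: v + s *: u) - g (x + s *: u).
pose dphi (s : R) := p (x + t *: v + s *: u) - p (x + s *: u).
have dphiE (s : R) : is_derive s 1 phi (dphi s).
  by apply: is_deriveB; apply: is_derive_line.
have [|s sI E] := @MVT R phi dphi 0 t t0 (fun s _ => dphiE s).
  apply: continuous_subspaceT => s; apply: differentiable_continuous.
  by apply/derivable1_diffP; case: (dphiE s).
move: sI; rewrite in_itv /= => /andP[s0 st].
have -> : g (x + t *: u + t *: v) - g (x + t *: u) - g (x + t *: v) + g x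
    = t * dphi s.
  move: E; rewrite /phi !scale0r !addr0 subr0 (addrAC x) => E.
  by rewrite mulrC -E; ring.
have le1 : `|t *: v + s *: u| <= t * (`|u| + `|v|).
  rewrite (le_trans (ler_normD _ _)) // !normrZ !gtr0_norm // mulrDr addrC.
  by rewrite lerD2r ler_wpM2r // ltW.
have le2 : `|s *: u| <= t * `|u|.
  by rewrite normrZ gtr0_norm // ler_wpM2r // ltW.
have ltr_ (a : R) : a < M -> t * a < r.
  move=> aM; rewrite ltr_pdivlMr // in tr; apply: le_lt_trans tr.
  by rewrite ler_wpM2l // ltW.
have := hr _ (le_lt_trans le1 (ltr_ _ _)).
have := hr _ (le_lt_trans le2 (ltr_ _ _)).
have -> : 'd p x (t *: v + s *: u) = t * 'd p x v + s * 'd p x u.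
  by rewrite linearD !linearZ.
have -> : 'd p x (s *: u) = s * 'd p x u by rewrite linearZ.
rewrite addrA; move: ('d p x v) ('d p x u) => Dv Du h1 h2.
have vN := normr_ge0 v; have uN := normr_ge0 u.
have {}h1 : `|p (x + s *: u) - p x - s * Du| <= e / M * (t * `|u|).
  apply: le_trans; first by apply: h1; rewrite /M; lra.
  by rewrite ler_wpM2l // ltW // divr_gt0.
have {}h2 : `|p (x + t *: v + s *: u) - p x - (t * Dv + s * Du)|
    <= e / M * (t * (`|u| + `|v|)).
  apply: le_trans; first by apply: h2; rewrite /M; lra.
  by rewrite ler_wpM2l // ltW // divr_gt0.
have -> : t * dphi s - t ^+ 2 * Dv = t * (dphi s - t * Dv) by ring.
rewrite normrM gtr0_norm // expr2 mulrCA ler_pM2l //.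
have -> : dphi s - t * Dv =
  (p (x + t *: v + s *: u) - p x - (t * Dv + s * Du))
  - (p (x + s *: u) - p x - s * Du).
  by rewrite /dphi; ring.
apply: le_trans (ler_normB _ _) _; apply: le_trans (lerD h2 h1) _.
rewrite -mulrDr -mulrA ler_pM2l // mulrC ler_pdivrMr // -mulrDr.
by rewrite ler_pM2l // /M; lra.
Qed.

(** Schwarz's theorem: the second difference is symmetric in [u] and [v], and for small [t] its
    quotient by [t ^+ 2] is within [e / 2] of each mixed derivative. *)
Lemma diff_partials_sym (R : realType) (V : normedModType R) (g p q : V -> R)
    (x u v : V) :
  (forall y, is_derive y u g (p y)) -> (forall y, is_derive y v g (q y)) ->
  differentiable p x -> differentiable q x -> 'd p x v = 'd q x u.
Proof.
move=> dgp dgq dp dq; apply/eqP; rewrite -subr_eq0 -normr_le0.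
apply/ler_addgt0Pl => e e0; rewrite addr0.
have e2 : 0 < e / 2 by rewrite divr_gt0.
have [r r0 hr] := second_difference v e2 dgp dp.
have [r' r'0 hr'] := second_difference u e2 dgq dq.
pose t := Num.min r r' / 2.
have m0 : 0 < Num.min r r' by rewrite lt_min r0.
have t0 : 0 < t by rewrite divr_gt0.
have tm : t < Num.min r r' by rewrite ltr_pdivrMr // mulr2n ?mulrDr ?mulr1 ltrDl.
move: tm; rewrite lt_min => /andP[tr tr'].
have h := hr t; rewrite t0 tr in h; have {}h := h isT.
have := hr' t; rewrite t0 tr' => /(_ isT).
rewrite (addrAC x (t *: v)) => h'.
rewrite -(ler_pM2l (exprn_gt0 2 t0)) -[X in X * _]gtr0_norm ?exprn_gt0 // -normrM.
set D1 := 'd p x v in h *; set D2 := 'd q x u in h' *.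
have -> : t ^+ 2 * (D1 - D2) =
  (g (x + t *: u + t *: v) - g (x + t *: v) - g (x + t *: u) + g x - t ^+ 2 * D2)
  - (g (x + t *: u + t *: v) - g (x + t *: u) - g (x + t *: v) + g x - t ^+ 2 * D1).
  by ring.
apply: le_trans (ler_normB _ _) _; apply: le_trans (lerD h' h) _.
by rewrite -mulrDl -splitr mulrC.
Qed.

Lemma hess_sym (R : realType) (m : nat) (g : 'cV[R]_m -> R) (x : 'cV[R]_m) :
  (forall y, differentiable g y) -> differentiable (grad g) x ->
  (hess g x)^T = hess g x.
Proof.
move=> dg dgg; apply/matrixP => i j; rewrite !mxE.
have dp k y : is_derive y (delta_mx k 0) g (grad g y k 0).
  by rewrite mxE; apply: DeriveDef => //; exact: diff_derivable.
have dgk k : differentiable (fun y => grad g y k 0) x.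
  exact: (differentiable_comp (g := fun N : 'cV[R]_m => N k 0) dgg
    (differentiable_coord _ _ _)).
have E (k l : 'I_m) : ('D_(delta_mx k 0) (grad g) x) l 0
    = 'd (fun y => grad g y l 0) x (delta_mx k 0).
  rewrite -deriveE // derive_mx ?mxE //; exact: diff_derivable.
exact: etrans (E j i) (etrans
  (diff_partials_sym (dp i) (dp j) (dgk i) (dgk j)) (esym (E i j))).
Qed.

(** Insert [t *: x + (1 - t) *: y] in the definition, divide by [t] and let [t] tend to 0 from the
    right; [F] is the difference quotient and [G] its upper bound. *)
Lemma strongly_convex_first_order (R : realType) (m : nat) (mu : R)
    (g : 'cV[R]_m -> R) (x y : 'cV[R]_m) :
  strongly_convex mu g -> differentiable g y ->
  g y + dot (grad g y) (x - y) + mu / 2 * dot (x - y) (x - y) <= g x.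
Proof.
move=> sc dg.
pose F (t : R) := t^-1 *: ((g \o shift y) (t *: (x - y)) - g y).
pose G (t : R) := g x - g y - mu / 2 * (1 - t) * dot (x - y) (x - y).
have cF : F t @[t --> 0^'+] --> dot (grad g y) (x - y).
  rewrite -derive_grad //; apply: cvg_dnbhs_at_right.
  exact: (@diff_derivable _ _ _ g y (x - y) dg).
have cG : G t @[t --> 0^'+] --> G 0.
  apply: cvg_at_right_filter; apply: differentiable_continuous.
  apply/derivable1_diffP; rewrite /G; apply: ex_derive.
have : dot (grad g y) (x - y) <= G 0.
  rewrite -(cvg_lim _ cF) // -(cvg_lim _ cG) //.
  apply: ler_lim; [by apply/cvg_ex; exists (dot (grad g y) (x - y))|
                   by apply/cvg_ex; exists (G 0)|].
  near=> t.
  have t0 : 0 < t by near: t; exact: nbhs_right_gt.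
  have t1 : t < 1 by near: t; exact: nbhs_right_lt.
  have := sc x y t; rewrite ltW // ltW // => /(_ isT).
  rewrite enorm_sqr /F /G /= -[_ *: (_ - _)]/(_ * _) => h.
  rewrite mulrC ler_pdivrMr //.
  have -> : t *: (x - y) + y = t *: x + (1 - t) *: y.
    by rewrite scalerBr scalerBl scale1r -!addrA; congr (_ + _); rewrite addrC.
  lra.
rewrite /G subr0 mulr1; lra.
Unshelve. all: by end_near. Qed.

(** Sum of the first-order bounds at [x] and at [y]; each contributes half of [mu]. *)
Lemma strongly_convex_monotone (R : realType) (m : nat) (mu : R)
    (g : 'cV[R]_m -> R) (x y : 'cV[R]_m) :
  strongly_convex mu g -> (forall z, differentiable g z) ->
  mu * dot (x - y) (x - y) <= dot (grad g x - grad g y) (x - y).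
Proof.
move=> sc dg.
have := strongly_convex_first_order x sc (dg y).
have := strongly_convex_first_order y sc (dg x).
have -> : y - x = - (x - y) by rewrite opprB.
rewrite (dotBl (grad g x)); move: (x - y) => z; rewrite !(dotNr, dotNl) opprK; lra.
Qed.

(** Strong monotonicity of the gradient bounds its difference quotients along [v]; the bound defines
    a closed half-space, so it passes to the limit. *)
Lemma hess_coercive (R : realType) (m : nat) (mu : R)
    (g : 'cV[R]_m -> R) (x v : 'cV[R]_m) :
  strongly_convex mu g -> class_C2 g ->
  mu * dot v v <= dot (hess g x *m v) v.
Proof.
move=> sc [dg dgg _].
(* [hess] is a transposed Jacobian, while the derivative along [v] is the Jacobian applied to [v];
   symmetry identifies them. *)
rewrite -(hess_sym (x := x)) // -derive_nabla //.
pose F (t : R) := t^-1 *: ((grad g \o shift x) (t *: v) - grad g x).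
have cF : F t @[t --> 0^'] --> 'D_v (grad g) x by exact: diff_derivable.
have : closed [set u : 'cV[R]_m | mu * dot v v <= dot u v].
  by apply: (@closed_comp _ _ (fun u => dot u v) [set a | mu * dot v v <= a]);
    [move=> u _; exact: continuous_dotl|exact: closed_ge].
move=> cl; apply: (closed_cvg _ cl _ _ cF).
near=> t.
have t0 : t != 0 by near: t; exact: nbhs_dnbhs_neq.
have := strongly_convex_monotone (t *: v + x) x sc dg.
rewrite addrK !(dotZl, dotZr) /F /= => h.
rewrite dotZl -(ler_pM2l (_ : 0 < t ^+ 2)) ?exprn_even_gt0 //.
move: (dot (_ - _) v) h => X h.
have -> : t ^+ 2 * (t^-1 * X) = t * X by field.
by have -> : t ^+ 2 * (mu * dot v v) = mu * (t * (t * dot v v)) by ring.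
Unshelve. all: by end_near. Qed.

(** The Lipschitz bound puts the difference quotients of the gradient along [v] into a closed ball,
    which contains their limit. *)
Lemma hess_bounded (R : realType) (m : nat) (L : R)
    (g : 'cV[R]_m -> R) (x v : 'cV[R]_m) :
  lipschitz_grad L g -> class_C2 g ->
  dot (hess g x *m v) (hess g x *m v) <= L ^+ 2 * dot v v.
Proof.
move=> lg [dg dgg _].
rewrite -(hess_sym (x := x)) // -derive_nabla //.
pose F (t : R) := t^-1 *: ((grad g \o shift x) (t *: v) - grad g x).
have cF : F t @[t --> 0^'] --> 'D_v (grad g) x by exact: diff_derivable.
have : closed [set u : 'cV[R]_m | dot u u <= L ^+ 2 * dot v v].
  by apply: (@closed_comp _ _ (fun u => dot u u) [set a | a <= L ^+ 2 * dot v v]);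
    [move=> u _; exact: continuous_dot_sqr|exact: closed_le].
move=> cl; apply: (closed_cvg _ cl _ _ cF).
near=> t.
have t0 : t != 0 by near: t; exact: nbhs_dnbhs_neq.
have := lg (t *: v + x) x.
rewrite addrK -(@ler_pXn2r _ 2) ?nnegrE ?sqrtr_ge0 //; last first.
  by have := le_trans (sqrtr_ge0 _) (lg (t *: v + x) x); rewrite addrK.
rewrite exprMn !enorm_sqr /F /= !(dotZl, dotZr) => h.
rewrite -(ler_pM2l (_ : 0 < t ^+ 2)) ?exprn_even_gt0 //.
apply: le_trans (le_trans h _); rewrite le_eqVlt; apply/orP; left; apply/eqP.
  by field.
by ring.
Unshelve. all: by end_near. Qed.

(** * Expectations over finite words of choices *)

(** Choices are appended on the right, so that a word is a history with its latest choice last, and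
    splitting off that letter is conditioning on the past. *)
Fixpoint words (I : finType) (k : nat) : seq (seq I) :=
  if k is k'.+1 then [seq rcons c i | c <- words I k', i <- enum I]
  else [:: [::]].

Lemma mem_words (I : finType) k (c : seq I) : (c \in words I k) = (size c == k).
Proof.
elim: k c => [|k IH] c /=; first by rewrite inE size_eq0.
apply/allpairsP/eqP => [[[c' i] /= [+ _ ->]]|].
  by rewrite IH size_rcons => /eqP ->.
case/lastP: c => // c i; rewrite size_rcons => -[sc].
by exists (c, i); rewrite /= IH sc eqxx mem_enum.
Qed.

Lemma uniq_words (I : finType) k : uniq (words I k).
Proof.
elim: k => //= k IH; apply: allpairs_uniq => //; first exact: enum_uniq.
by move=> [c i] [c' i'] _ _ /= /rcons_inj [-> ->].
Qed.

Definition word_mean (R : realType) (I : finType) (law : I -> R) (k : nat)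
    (G : seq I -> R) : R :=
  \sum_(c <- words I k) (\prod_(i <- c) law i) * G c.

Lemma word_mean0 (R : realType) (I : finType) (law : I -> R) (G : seq I -> R) :
  word_mean law 0 G = G [::].
Proof. by rewrite /word_mean big_seq1 big_nil mul1r. Qed.

(** Tower property: average over the last choice first, with the past fixed. *)
Lemma word_meanS (R : realType) (I : finType) (law : I -> R) k (G : seq I -> R) :
  word_mean law k.+1 G =
  word_mean law k (fun c => \sum_i law i * G (rcons c i)).
Proof.
rewrite /word_mean /= big_allpairs_dep; apply: eq_bigr => c _.
rewrite big_distrr big_enum /=; apply: eq_bigr => i _.
by rewrite -cats1 big_cat big_seq1 /= mulrA.
Qed.

Section Histories.
Context {R : realType} {disp : measure_display} {T : measurableType disp}.
Context (P : probability T R) (I : finType) (law : I -> R) (xi : nat -> T -> I).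
Hypothesis iid : iid_choices P law xi.

Let event (c : seq I) : set T := [set o | mkseq (xi ^~ o) (size c) = c].

(** The default in [nth i c j] is the bound [i] itself: the formula makes sense without an
    inhabitant of [I], and positions past the end of [c] impose no condition. *)
Let eventE (c : seq I) : event c =
  \bigcap_(j in [set` iota 0 (size c)]) (xi j @^-1` [set i | nth i c j = i]).
Proof.
apply/seteqP; split => [w /= e j|w h] /=.
  rewrite mem_iota add0n => /andP[_ jc].
  by rewrite -[in LHS]e nth_mkseq.
case: c h => [|i0 c] h //; apply: (@eq_from_nth _ i0); first by rewrite size_mkseq.
move=> j; rewrite size_mkseq => jc; rewrite nth_mkseq //.
have jI : j \in iota 0 (size (i0 :: c)) by rewrite mem_iota.
by rewrite -[LHS](h j jI); exact: set_nth_default.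
Qed.

Let measurable_event c : measurable (event c).
Proof.
case: iid => mxi _ _; rewrite eventE; apply: fin_bigcap_measurable.
  exact: finite_seq.
by move=> j _; exact: mxi.
Qed.

Let P_event c : P (event c) = (\prod_(i <- c) law i)%:E.
Proof.
case: iid => _ lxi indep; rewrite eventE indep ?iota_uniq //.
rewrite -prodEFin.
case: c => [|i0 c]; first by rewrite !big_nil.
rewrite [RHS](big_nth i0) /index_iota subn0.
apply: eq_big_seq => j; rewrite mem_iota add0n => /andP[_ jc].
rewrite -(lxi j); congr (P (_ @^-1` _)); apply/seteqP; split => i /=.
  by rewrite (set_nth_default i0) // => ->.
by move=> ->; exact: set_nth_default.
Qed.

(* The bound on the surrogates is assumed outcome by outcome; positivity of the
   law makes it available along every finite word of choices. *)
Lemma history_realized (c : seq I) : (forall i, 0 < law i) ->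
  exists o, mkseq (xi ^~ o) (size c) = c.
Proof.
move=> law0; have : event c !=set0.
  apply/set0P/eqP => e0; have := P_event c.
  rewrite e0 measure0 => /eqP; rewrite eqe lt_eqF //.
  by apply: prodr_gt0.
by case=> o; exists o.
Qed.

(** The integrand is a finite combination of indicators of the events [event c]; nonnegativity of
    [G] lets the integral be split without an integrability argument. *)
Lemma expectation_history k (G : seq I -> R) : (forall c, 0 <= G c) ->
  ('E_P[fun o => G (mkseq (xi ^~ o) k)] = (word_mean law k G)%:E)%E.
Proof.
move=> G0; rewrite unlock.
under eq_integral.
  move=> o _.
  rewrite (_ : (G _)%:E =
      \sum_(c <- words I k) ((G c)%:E * (\1_(event c) o)%:E))%E; last first.
    rewrite (bigD1_seq (mkseq (xi ^~ o) k)) ?uniq_words //=; last first.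
      by rewrite mem_words size_mkseq.
    rewrite indicE mem_set ?mule1 /event /= ?size_mkseq //.
    rewrite big1_seq ?adde0 // => c /andP[nc].
    rewrite mem_words => /eqP sc.
    rewrite indicE memNset ?mule0 //= sc => e; by rewrite e eqxx in nc.
  over.
rewrite ge0_integral_sum //=; last 2 first.
- move=> c; apply: measurable_funeM; apply/measurable_EFinP.
  exact: measurable_indic.
- by move=> c o _; rewrite mule_ge0 ?lee_fin.
rewrite /word_mean -sumEFin; apply: eq_bigr => c _.
rewrite ge0_integralZl_EFin //; last first.
  by apply/measurable_EFinP; exact: measurable_indic.
rewrite mulrC EFinM -P_event; congr (_ * _)%E.
by rewrite integral_indic // setIT.
Qed.

End Histories.

(** * The Jacobian of F and the surrogates *)

Lemma derive_linear (R : realType) (p : nat) (W : normedModType R)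
    (h : {linear 'cV[R]_p -> W}) (z u : 'cV[R]_p) : 'D_u h z = h u.
Proof.
rewrite deriveE; last exact: differentiable_linear_col.
by rewrite diff_lin //; exact: linear_col_continuous.
Qed.

Lemma is_derive_linear (R : realType) (V W : normedModType R) (m : nat)
    (h : {linear 'cV[R]_m -> W}) (G : V -> 'cV[R]_m) (x v : V) dG :
  is_derive x v G dG -> is_derive x v (fun y => h (G y)) (h dG).
Proof.
move=> [d1 <-].
have E : (fun s : R => s^-1 *: (((fun y => h (G y)) \o shift x) (s *: v) - h (G x)))
    = h \o (fun s : R => s^-1 *: ((G \o shift x) (s *: v) - G x)).
  apply/funext => s; rewrite [in RHS]/comp linearZ_LR [in RHS]linearB //.
have C : h (s^-1 *: ((G \o shift x) (s *: v) - G x)) @[s --> 0^'] --> h ('D_v G x).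
  by apply: continuous_cvg; [exact: linear_col_continuous|exact: d1].
apply: DeriveDef; rewrite /derivable /derive E; last exact: cvg_lim.
by apply/cvg_ex; exists (h ('D_v G x)).
Qed.

Lemma is_derive_comp_linear (R : realType) (V V' W : normedModType R)
    (h : {linear V -> V'}) (G : V' -> W) (x v : V) dG :
  is_derive (h x) (h v) G dG -> is_derive x v (fun y => G (h y)) dG.
Proof.
have E : (fun s : R => s^-1 *: (((fun y => G (h y)) \o shift x) (s *: v) - G (h x)))
    = (fun s : R => s^-1 *: ((G \o shift (h x)) (s *: h v) - G (h x))).
  by apply/funext => s /=; rewrite linearP.
by move=> [d1 d2]; apply: DeriveDef; rewrite ?/derivable ?/derive E.
Qed.

Lemma unitmx_inj_col (F : fieldType) (p : nat) (A : 'M[F]_p) :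
  (forall v : 'cV_p, A *m v = 0 -> v = 0) -> A \in unitmx.
Proof.
move=> inj; rewrite -unitmx_tr -row_free_unit -kermx_eq0.
apply/rowV0P => v /sub_kermxP v0; apply: trmx_inj; rewrite trmx0.
by apply: inj; rewrite -[A]trmxK -trmx_mul v0 trmx0.
Qed.

(** With [J] and [W] invertible the matrix has a two-sided inverse, which satisfies the Penrose
    equations; uniqueness concludes. *)
Lemma pinv_congruence (R : realType) (p : nat) (J W : 'M[R]_p) :
  J \in unitmx -> W \in unitmx ->
  Defs.pinv (J *m invmx W *m J^T) = (invmx J)^T *m W *m invmx J.
Proof.
move=> uJ uW; apply: is_pinv_uniq (pinvP _) _.
have AB : J *m invmx W *m J^T *m ((invmx J)^T *m W *m invmx J) = 1%:M.
  rewrite !mulmxA -(mulmxA _ J^T) -trmx_mul mulVmx // trmx1 mulmx1.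
  by rewrite mulmxKV // mulmxV.
have BA : (invmx J)^T *m W *m invmx J *m (J *m invmx W *m J^T) = 1%:M.
  rewrite !mulmxA mulmxKV // mulmxK // -trmx_mul mulmxV // trmx1 //.
by split; rewrite ?AB ?BA ?mul1mx ?trmx1.
Qed.

(** * Block structure of F, its Jacobian and the Newton direction *)

Section Blocks.
Context {R : realType} {n d : nat}.
Implicit Types (x y v : pt R n d).

Fact wpart_is_linear : linear (@wpart R n d).
Proof. by move=> c x y; apply/matrixP => i j; rewrite !mxE. Qed.
HB.instance Definition _ := GRing.isLinear.Build R (pt R n d) 'cV[R]_d _
  (@wpart R n d) wpart_is_linear.

(* [apart] with the index first, so that HB can attach a linear structure. *)
Definition block (i : 'I_n) (x : pt R n d) : 'cV[R]_d := apart x i.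

Fact block_is_linear (i : 'I_n) : linear (block i).
Proof. by move=> c x y; apply/matrixP => k j; rewrite !mxE. Qed.
HB.instance Definition _ (i : 'I_n) := GRing.isLinear.Build R (pt R n d) 'cV[R]_d _
  (block i) (block_is_linear i).

Lemma wpart_stack (w : 'cV[R]_d) (a : 'I_n -> 'cV[R]_d) : wpart (stack w a) = w.
Proof. by rewrite /wpart mxcolK unlift_none. Qed.

Lemma apart_stack (w : 'cV[R]_d) (a : 'I_n -> 'cV[R]_d) i :
  apart (stack w a) i = a i.
Proof. by rewrite /apart mxcolK liftK. Qed.

Lemma pt_eqP x y : wpart x = wpart y -> (forall i, apart x i = apart y i) -> x = y.
Proof.
move=> ew ea; apply/mxcolP => i.
by case: (unliftP ord0 i) => [j ->|->]; [exact: ea|exact: ew].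
Qed.

Lemma apartB x y i : apart (x - y) i = apart x i - apart y i.
Proof. exact: (linearB (block i)). Qed.

Lemma dot_blocks x y :
  dot x y = dot (wpart x) (wpart y) + \sum_i dot (apart x i) (apart y i).
Proof.
rewrite dotE -{1}(submxcolK x) -{1}(submxcolK y) tr_mxcol mul_mxrow_mxcol.
rewrite summxE big_ord_recl -dotE; congr (_ + _).
by apply: eq_bigr => i _; rewrite -dotE.
Qed.

Variable f : 'I_n -> 'cV[R]_d -> R.

Lemma wpart_Wnewton x v j :
  wpart (Wnewton f x j *m v) = hess (f j) (wpart x) *m wpart v.
Proof. by rewrite -{1}(submxcolK v) /wpart mul_mxdiag_mxcol mxcolK. Qed.

Lemma apart_Wnewton x v j i : apart (Wnewton f x j *m v) i = apart v i.
Proof. by rewrite -{1}(submxcolK v) /apart mul_mxdiag_mxcol mxcolK mul1mx. Qed.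

Hypothesis n_gt0 : (0 < n)%N.
Hypothesis f_C2 : forall i, class_C2 (f i).

Let hessT i (w : 'cV[R]_d) : (hess (f i) w)^T = hess (f i) w.
Proof. by case: (f_C2 i) => dg dgg _; exact: hess_sym. Qed.

Lemma Fmap_differentiable x : differentiable (Fmap f) x.
Proof.
apply: differentiable_col => a.
(* Coordinate [a] of the stacked vector is coordinate [tagnat.sig2 a] of block [tagnat.sig1 a]. *)
have -> : (fun y => Fmap f y a 0) = (fun y =>
  (if unlift ord0 (tagnat.sig1 a) is Some j then grad (f j) (wpart y) - apart y j
   else n%:R^-1 *: \sum_i apart y i) (tagnat.sig2 a) 0).
  by apply/funext => y; rewrite mxE.
apply: (differentiable_comp (g := fun N : 'cV[R]_d => N (tagnat.sig2 a) 0));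
  last exact: differentiable_coord.
have da i : differentiable (fun y : pt R n d => apart y i) x.
  exact: (differentiable_linear_col (block i)).
case: (unlift _ _) => [j|].
  apply: differentiableB; last exact: da.
  apply: (differentiable_comp (f := @wpart R n d) (g := grad (f j))).
    exact: differentiable_linear_col.
  by case: (f_C2 j).
have -> : (fun y : pt R n d => n%:R^-1 *: \sum_i apart y i)
  = n%:R^-1 *: \sum_i (fun y : pt R n d => apart y i).
  by apply/funext => y; rewrite /= fct_sumE.
by apply: differentiableZ; apply: differentiable_sum.
Qed.

Let is_derive_Fmap x v :
  is_derive x v (Fmap f) ((nabla (Fmap f) x)^T *m v).
Proof.
rewrite -derive_nabla; last exact: Fmap_differentiable.
by apply: DeriveDef => //; exact/diff_derivable/Fmap_differentiable.
Qed.

(** The first block of [Fmap f] is linear in [x], hence its own derivative. *)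
Lemma wpart_jacobian x v :
  wpart ((nabla (Fmap f) x)^T *m v) = n%:R^-1 *: \sum_i apart v i.
Proof.
have [_ <-] := is_derive_linear (@wpart R n d) (is_derive_Fmap x v).
have -> : (fun y => wpart (Fmap f y))
  = (fun y : pt R n d => n%:R^-1 *: \sum_i apart y i).
  by apply/funext => y; rewrite wpart_stack.
have lin : linear (fun y : pt R n d => n%:R^-1 *: \sum_i apart y i).
  move=> c y z; rewrite scalerA mulrC -scalerA -scalerDr; congr (_ *: _).
  rewrite scaler_sumr -big_split; apply: eq_bigr => i _.
  exact: (linearP (block i)).
pose h := GRing.isLinear.Build R (pt R n d) 'cV[R]_d _ _ lin.
pose H : {linear pt R n d -> 'cV[R]_d} :=
  HB.pack (fun y : pt R n d => n%:R^-1 *: \sum_i apart y i) h.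
exact: (derive_linear H).
Qed.

Lemma apart_jacobian x v i :
  apart ((nabla (Fmap f) x)^T *m v) i
  = hess (f i) (wpart x) *m wpart v - apart v i.
Proof.
rewrite -[LHS]/(block i _).
have [_ <-] := is_derive_linear (block i) (is_derive_Fmap x v).
have -> : (fun y => block i (Fmap f y))
  = (fun y => grad (f i) (wpart y)) - (fun y : pt R n d => apart y i).
  by apply/funext => y; rewrite /block apart_stack.
have [d1 d2 _] := f_C2 i.
have D1 : is_derive x v (fun y => grad (f i) (wpart y))
    (hess (f i) (wpart x) *m wpart v).
  apply: is_derive_comp_linear; rewrite -hessT -derive_nabla //.
  by apply: DeriveDef => //; exact: diff_derivable.
have D2 : is_derive x v (fun y : pt R n d => apart y i) (apart v i).
  apply: DeriveDef; last exact: (derive_linear (block i)).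
  exact/diff_derivable/(differentiable_linear_col (block i)).
by have [_ ->] := is_deriveB D1 D2.
Qed.

Variable mu : R.
Hypothesis mu_gt0 : 0 < mu.
Hypothesis f_sc : forall i, strongly_convex mu (f i).

Lemma hess_mul_eq0 i (w u : 'cV[R]_d) : hess (f i) w *m u = 0 -> u = 0.
Proof.
move=> h0; apply: dot_eq0; apply/eqP; rewrite eq_le dot_ge0 andbT.
have := hess_coercive w u (f_sc i) (f_C2 i).
by rewrite h0 dot0l pmulr_rle0.
Qed.

(* If [J v = 0], then [v_i = H_i v_0] and [\sum_i v_i = 0], so that
   [\sum_i <H_i v_0, v_0> = 0] and strong convexity gives [v_0 = 0]. *)
Lemma jacobian_unit x : (nabla (Fmap f) x)^T \in unitmx.
Proof.
apply: unitmx_inj_col => v v0.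
have n0 : n%:R != 0 :> R by rewrite pnatr_eq0 -lt0n.
have s0 : \sum_i apart v i = 0.
  have := wpart_jacobian x v; rewrite v0 linear0 => /esym/eqP.
  by rewrite scaler_eq0 invr_eq0 (negPf n0) => /eqP.
have aE i : apart v i = hess (f i) (wpart x) *m wpart v.
  have := apart_jacobian x v i; rewrite v0 => /esym/eqP.
  rewrite (_ : apart 0 i = 0); last exact: (linear0 (block i)).
  by rewrite subr_eq0 => /eqP.
have w0 : wpart v = 0.
  apply: dot_eq0; apply/eqP; rewrite eq_le dot_ge0 andbT.
  rewrite -(pmulr_rle0 _ mu_gt0) -(pmulr_rle0 _ (_ : 0 < n%:R :> R)) ?ltr0n //.
  have <- : dot (\sum_i apart v i) (wpart v) = 0 by rewrite s0 dot0l.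
  rewrite dot_suml -[n in n%:R]card_ord mulr_natl -sumr_const.
  by apply: ler_sum => i _; rewrite aE; exact: hess_coercive.
apply: pt_eqP => [|i]; first by rewrite linear0.
by rewrite aE w0 mulmx0; apply/esym/(linear0 (block i)).
Qed.

Lemma Wnewton_unit x j : Wnewton f x j \in unitmx.
Proof.
apply: unitmx_inj_col => v v0; apply: pt_eqP => [|i].
  rewrite linear0; apply: (@hess_mul_eq0 j (wpart x)).
  by rewrite -wpart_Wnewton v0 linear0.
by rewrite -(apart_Wnewton x v j i) v0.
Qed.

Lemma Wnewton_sym x j : (Wnewton f x j)^T = Wnewton f x j.
Proof.
rewrite /Wnewton tr_mxdiag; apply: eq_mxdiag => i.
by case: ifP => _; [exact: hessT|exact: trmx1].
Qed.

(* The full Newton direction, up to sign; the surrogate at [x] is half of its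
   squared [W]-norm. *)
Definition newton_dir x : pt R n d := invmx ((nabla (Fmap f) x)^T) *m Fmap f x.

(** An [alpha] block of the Newton equation [J N = F(x)], solved for [N_i]; the next lemma reads off
    the first block. *)
Lemma apart_newton_dir x i :
  apart (newton_dir x) i =
  hess (f i) (wpart x) *m wpart (newton_dir x) - (grad (f i) (wpart x) - apart x i).
Proof.
have := apart_jacobian x (newton_dir x) i.
rewrite mulKVmx ?jacobian_unit // apart_stack => ->; rewrite opprB addrC.
by rewrite -addrA addNr addr0.
Qed.

Lemma sum_apart_newton_dir x :
  \sum_i apart (newton_dir x) i = \sum_i apart x i.
Proof.
have n0 : n%:R^-1 != 0 :> R by rewrite invr_eq0 pnatr_eq0 -lt0n.
have := wpart_jacobian x (newton_dir x).
by rewrite mulKVmx ?jacobian_unit // wpart_stack => /(scalerI n0).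
Qed.

Section Surrogate.
Variables (x : pt R n d) (W : ptmx R n d).
Hypotheses (uW : W \in unitmx) (sW : W^T = W).
Local Notation J := (nabla (Fmap f) x)^T.

Let surrogateE (y : pt R n d) :
  surrogate f x W y =
    2^-1 * dot (((invmx J)^T *m W *m invmx J) *m Fmap f y) (Fmap f y).
Proof.
rewrite /surrogate -[X in _ *m X](trmxK (nabla (Fmap f) x)).
by rewrite pinv_congruence // jacobian_unit.
Qed.

Lemma surrogate_center :
  surrogate f x W x = 2^-1 * dot (W *m newton_dir x) (newton_dir x).
Proof.
by rewrite surrogateE -!mulmxA (dot_mulmxl (invmx J)^T) trmxK.
Qed.

(** The surrogate is half the quadratic form of [B] at [Fmap f]. Symmetry of [W] makes [B]
    symmetric, so the derivative along [v] is [<B F, J v>], and [J^T B F = W J^-1 F = W N]. *)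
Lemma dot_grad_surrogate v :
  dot (grad (surrogate f x W) x) v = dot (W *m newton_dir x) v.
Proof.
set B := (invmx J)^T *m W *m invmx J.
have sB : B^T = B by rewrite /B !trmx_mul trmxK sW mulmxA.
have D u : is_derive x u (surrogate f x W) (dot (B *m Fmap f x) (J *m u)).
  have -> : surrogate f x W = 2^-1 *: (fun y => dot (B *m Fmap f y) (Fmap f y)).
    by apply/funext => y; rewrite surrogateE.
  have dF := is_derive_Fmap x u.
  have dBF := is_derive_linear (mulmx B) dF.
  apply: is_derive_eq; first exact: (is_deriveZ _ (is_derive_dot dBF dF)).
  rewrite (dot_mulmxl B (J *m u)) sB (dotC (J *m u)) -[_ *: _]/(_ * _).
  by move: (dot _ _) => D; field.
have -> : dot (grad (surrogate f x W) x) v = dot (B *m Fmap f x) (J *m v).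
  rewrite {2}(col_sum_delta v) mulmx_sumr dotC (dotC (B *m _)) dot_suml.
  apply: eq_bigr => i _; rewrite mxE; have [_ ->] := D (delta_mx i 0).
  by rewrite -scalemxAr dotZl (dotC _ (B *m _)).
rewrite dotC dot_mulmxl dotC /B; congr (dot _ v).
rewrite !mulmxA -(mulmxA _ _ (Fmap f x)) -trmx_mul mulVmx ?jacobian_unit //.
by rewrite trmx1 mul1mx -mulmxA.
Qed.

End Surrogate.
End Blocks.

(** * Recursion and constants *)

(** Minimality makes every one-sided directional derivative nonnegative; the direction opposite to
    the gradient then forces the gradient to vanish. *)
Lemma grad_at_min (R : realType) (m : nat) (g : 'cV[R]_m -> R) (x : 'cV[R]_m) :
  differentiable g x -> (forall y, g x <= g y) -> grad g x = 0.
Proof.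
move=> dg xmin.
have ge0 v : 0 <= dot (grad g x) v.
  pose F (t : R) := t^-1 *: ((g \o shift x) (t *: v) - g x).
  have cF : F t @[t --> 0^'+] --> dot (grad g x) v.
    rewrite -derive_grad //; apply: cvg_dnbhs_at_right.
    exact: (@diff_derivable _ _ _ g x v dg).
  rewrite -(cvg_lim _ cF) //; apply: limr_ge.
    by apply/cvg_ex; exists (dot (grad g x) v).
  near=> t.
  have t0 : 0 < t by near: t; exact: nbhs_right_gt.
  rewrite /F /= -[_ *: _]/(_ * _).
  by rewrite mulr_ge0 ?invr_ge0 ?(ltW t0) // subr_ge0.
apply: dot_eq0; apply/eqP; rewrite eq_le dot_ge0 andbT.
by rewrite -oppr_ge0 -dotNr.
Unshelve. all: by end_near. Qed.

Section Recursion.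
Context {R : realType} (I : finType) (law : I -> R).
Hypothesis law_ge0 : forall i, 0 <= law i.

Lemma word_mean_le k (G G' : seq I -> R) : (forall c, G c <= G' c) ->
  word_mean law k G <= word_mean law k G'.
Proof.
by move=> GG'; apply: ler_sum => c _; rewrite ler_wpM2l // prodr_ge0.
Qed.

Lemma word_meanZ k (a : R) (G : seq I -> R) :
  word_mean law k (fun c => a * G c) = a * word_mean law k G.
Proof. by rewrite /word_mean mulr_sumr; apply: eq_bigr => c _; rewrite mulrCA. Qed.

(** [V c i] plays the surrogate value after history [c] with next choice [i]. The descent holds for
    every later choice [i'], so averaging over [i'] and then [i] turns the gain into the factor
    [1 - gamma * rho]: the 2 in the rate cancels the half in the descent. *)
Lemma word_mean_decay (V q : seq I -> I -> R) (gamma rho : R) (k : nat) :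
  \sum_i law i = 1 -> 0 <= gamma -> gamma * rho <= 1 ->
  (forall c i i', V (rcons c i) i' <= V c i - gamma / 2 * q c i) ->
  (forall c, 2 * rho * \sum_i law i * V c i <= \sum_i law i * q c i) ->
  word_mean law k (fun c => \sum_i law i * V c i)
    <= (1 - gamma * rho) ^+ k * \sum_i law i * V [::] i.
Proof.
move=> law1 g0 gr1 desc rate; elim: k => [|k IH].
  by rewrite word_mean0 expr0 mul1r.
rewrite word_meanS exprS -mulrA.
apply: le_trans (ler_wpM2l _ IH); last by rewrite subr_ge0.
rewrite -word_meanZ; apply: word_mean_le => c.
have h : \sum_i law i * (\sum_i' law i' * V (rcons c i) i')
    <= \sum_i law i * (V c i - gamma / 2 * q c i).
  apply: ler_sum => i _; apply: ler_wpM2l => //.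
  have e b : b = \sum_i' law i' * b by rewrite -mulr_suml law1 mul1r.
  rewrite [leRHS]e; apply: ler_sum => i' _.
  exact: ler_wpM2l.
apply: le_trans h _.
under eq_bigr do rewrite mulrBr mulrCA.
rewrite sumrB -mulr_sumr.
by have := ler_wpM2l g0 (rate c); lra.
Qed.

End Recursion.

(** * Explicit constants of the rate and of the error bound *)

Section Scalars.
Context {R : realType} (mu L : R).
Hypotheses (mu_gt0 : 0 < mu) (mu_le_L : mu <= L).

Let m := Num.min 1 (mu ^+ 3).
Let c := Num.min 1 mu.
Let M2 := Num.max 1 (L ^+ 2).
Let M3 := Num.max 1 (L ^+ 3).
Let D := (2 + L ^+ 2) ^+ 2.

Let L_gt0 : 0 < L. Proof. exact: lt_le_trans mu_le_L. Qed.

Let mE : m = c ^+ 3.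
Proof.
rewrite /m /c; case: (leP 1 mu) => h; case: (leP 1 (mu ^+ 3)) => h3 //.
- by rewrite expr1n.
- by move: h3; rewrite ltNge exprn_ege1.
- by move: h3; rewrite expr_ge1 ?(ltW mu_gt0) // leNgt h.
Qed.

Let c_gt0 : 0 < c. Proof. by rewrite lt_min ltr01. Qed.
Let c_le1 : c <= 1. Proof. by rewrite ge_min lexx. Qed.
Let c_le_mu : c <= mu. Proof. by rewrite ge_min lexx orbT. Qed.
Let m_gt0 : 0 < m. Proof. by rewrite mE exprn_gt0. Qed.
Let m_le_c2 : m <= c ^+ 2.
Proof. by rewrite mE exprS ler_piMl ?exprn_ge0 // ltW. Qed.
Let c2_le_mu2 : c ^+ 2 <= mu ^+ 2.
Proof. by rewrite ler_pXn2r // nnegrE ltW. Qed.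
Let m_le_c : m <= c.
Proof.
by apply: le_trans m_le_c2 _; rewrite expr2 ler_piMl // ltW.
Qed.

Let M2_ge1 : 1 <= M2. Proof. by rewrite le_max lexx. Qed.
Let M3_ge1 : 1 <= M3. Proof. by rewrite le_max lexx. Qed.

(** [4 - (1 + L)^2 = (1 - L)(3 + L)] settles [L <= 1], and [4 L^2 - (1 + L)^2 = (L - 1)(3 L + 1)]
    the other case. *)
Let sqr_le_M3 : (1 + L) ^+ 2 <= 4 * M3.
Proof.
rewrite /M3; case: (leP L 1) => h.
  apply: (@le_trans _ _ 4); last by rewrite ler_peMr // le_max lexx.
  have : 0 <= (1 - L) * (3 + L) by rewrite mulr_ge0 ?subr_ge0 // addr_ge0 // ltW.
  by lra.
apply: (@le_trans _ _ (4 * L ^+ 3)); last by rewrite ler_pM2l // le_max lexx orbT.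
have h3 : L ^+ 2 <= L ^+ 3 by rewrite [leRHS]exprS ler_peMl ?exprn_ge0 // ltW.
have : 0 <= (L - 1) * (3 * L + 1).
  by rewrite mulr_ge0 ?subr_ge0 ?(ltW h) // addr_ge0 ?mulr_ge0 // ltW.
by lra.
Qed.

(** Origin of the 14 in the rate: [4 K <= 56 (1 + L^2) <= 14 D], the 4 coming from the previous
    bound. *)
Let D_M3 (K : R) : 0 <= K -> K <= (7 + 7 * L ^+ 2 ) * 2 ->
  K * (1 + L) ^+ 2 <= 14 * D * M3.
Proof.
move=> K0 hK; apply: (@le_trans _ _ (K * (4 * M3))).
  exact: ler_wpM2l K0 _ _ sqr_le_M3.
have M30 : 0 < M3 by exact: lt_le_trans M3_ge1.
rewrite mulrA ler_pM2r // /D.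
have : 0 <= L ^+ 4 by rewrite exprn_ge0 // ltW.
by lra.
Qed.

(** Arithmetic for SAN, summed over its [n + 1] choices: [p], [r2], [A] and [B] stand for the
    squared norms of [N_0], of the residuals, of the mean of the [alpha_i] and of the other blocks
    of [N], and [Q] for the sum of the Newton gains. *)
Lemma sum_rate (n : nat) (p r2 A B Q : R) : (0 < n)%N ->
  0 <= p -> 0 <= r2 -> 0 <= A ->
  mu ^+ 2 * p <= 2 * A + 2 * (r2 / n%:R) -> B <= 2 * n%:R * L ^+ 2 * p + 2 * r2 ->
  r2 <= (1 + L) ^+ 2 * Q ->
  m / (14 * n%:R ^+ 3 * D * M3) * ((1 + n%:R * L) * p + n.+1%:R * B)
    <= n%:R * A + Q.
Proof.
move=> n0 p0 r0 A0 hp hB hQ.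
have n1 : 1 <= n%:R :> R by rewrite ler1n.
have nn0 : 0 < n%:R :> R by rewrite ltr0n.
have M30 : 0 < M3 by exact: lt_le_trans M3_ge1.
have D0 : 0 < D by rewrite exprn_gt0 // ltr_wpDr // exprn_ge0 // ltW.
have Z0 : 0 < 14 * n%:R ^+ 3 * D * M3.
  by do 3 (apply: mulr_gt0 => //); exact: exprn_gt0.
rewrite -mulrA [_^-1 * _]mulrC mulrA ler_pdivrMr //.
rewrite -natr1; move: n%:R n1 nn0 hp hB Z0 => N n1 nn0 hp hB Z0.
set s := r2 / N in hp.
have rs : r2 = N * s by rewrite /s mulrC divfK // gt_eqF.
have s0 : 0 <= s by rewrite divr_ge0 // ltW.
clearbody s.
have L2 : 0 <= L ^+ 2 by rewrite exprn_ge0 // ltW.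
have LL : 2 * L <= 1 + L ^+ 2 by have := sqr_ge0 (L - 1); lra.
have Q0 : 0 <= Q.
  rewrite -(pmulr_rge0 _ (_ : 0 < (1 + L) ^+ 2)) ?exprn_gt0 ?addr_gt0 //.
  exact: le_trans hQ.
have mp : m * p <= 2 * A + 2 * s.
  by apply: le_trans hp; rewrite ler_wpM2r // (le_trans m_le_c2).
have m1 : m <= 1 by apply: le_trans c_le1.
have X1 : (1 + N * L) * p + (N + 1) * B
    <= N ^+ 2 * (1 + L + 4 * L ^+ 2) * p + 4 * N * r2.
  have h1 : (N + 1) * B <= 2 * N * (2 * N * L ^+ 2 * p + 2 * r2).
    apply: (@le_trans _ _ ((N + 1) * (2 * N * L ^+ 2 * p + 2 * r2))).
      by rewrite ler_wpM2l // addr_ge0 // ltW.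
    rewrite ler_wpM2r //; last by lra.
    by rewrite addr_ge0 ?mulr_ge0 // ltW.
  have h2 : (1 + N * L) * p <= N ^+ 2 * (1 + L) * p.
    rewrite ler_wpM2r //.
    have : N <= N ^+ 2 by rewrite expr2 ler_peMl // ltW.
    have := ltW L_gt0; nra.
  lra.
apply: le_trans (ler_wpM2l (ltW m_gt0) X1) _.
(* The coefficient of [N * r2] is [2 (1 + L + 4 L^2) + 4 = 6 + 2 L + 8 L^2], and
   [2 L <= 1 + L^2]. *)
pose K := 7 + 9 * L ^+ 2.
have X2 : m * (N ^+ 2 * (1 + L + 4 * L ^+ 2) * p + 4 * N * r2)
   <= N ^+ 2 * K * A + N * K * r2.
  have h1 : N ^+ 2 * (1 + L + 4 * L ^+ 2) * (m * p)
     <= N ^+ 2 * (1 + L + 4 * L ^+ 2) * (2 * A + 2 * s).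
    rewrite ler_wpM2l // mulr_ge0 ?exprn_ge0 ?(ltW nn0) //.
    by rewrite !addr_ge0 // ?mulr_ge0 // ltW.
  have h2 : m * (4 * N * r2) <= 4 * N * r2.
    by rewrite ler_piMl // !mulr_ge0 // ltW.
  have h3 : N ^+ 2 * s = N * r2 by rewrite rs; ring.
  have h4 : 0 <= N ^+ 2 * A by rewrite mulr_ge0 // exprn_ge0 // ltW.
  have h5 : 0 <= N * r2 by rewrite mulr_ge0 // ltW.
  have h6 : (1 + L + 4 * L ^+ 2) * 2 <= K by rewrite /K; lra.
  have h6' : (1 + L + 4 * L ^+ 2) * 2 + 4 <= K by rewrite /K; lra.
  have h7 := ler_wpM2r h4 h6; have h8 := ler_wpM2r h5 h6'.
  have e1 : N ^+ 2 * (1 + L + 4 * L ^+ 2) * (2 * A + 2 * s)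
    = (1 + L + 4 * L ^+ 2) * 2 * (N ^+ 2 * A) + (1 + L + 4 * L ^+ 2) * 2 * (N * r2).
    by rewrite -h3; ring.
  rewrite e1 in h1; move: h1 h2 h7 h8.
  have -> : m * (N ^+ 2 * (1 + L + 4 * L ^+ 2) * p + 4 * N * r2)
    = N ^+ 2 * (1 + L + 4 * L ^+ 2) * (m * p) + m * (4 * N * r2) by ring.
  have -> : N ^+ 2 * K * A + N * K * r2 = K * (N ^+ 2 * A) + K * (N * r2) by ring.
  lra.
apply: le_trans X2 _.
have K0 : 0 <= K by rewrite addr_ge0 // mulr_ge0.
have hK : K <= (7 + 7 * L ^+ 2) * 2 by rewrite /K; lra.
have b1 := D_M3 K0 hK.
have b2 : K <= 14 * D * M3.
  apply: le_trans b1; rewrite ler_peMr // -[leLHS](expr1n _ 2).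
  by rewrite ler_pXn2r // ?nnegrE ?addr_ge0 ?lerDl // ltW.
have N3 : N <= N ^+ 3 by rewrite exprS ler_peMr ?(ltW nn0) // exprn_ege1.
have a1 : N ^+ 2 * K * A <= 14 * N ^+ 3 * D * M3 * (N * A).
  have -> : N ^+ 2 * K * A = N * K * (N * A) by ring.
  rewrite ler_wpM2r ?mulr_ge0 ?(ltW nn0) //.
  have -> : 14 * N ^+ 3 * D * M3 = N ^+ 3 * (14 * D * M3) by ring.
  by apply: ler_pM => //; exact: ltW.
have a2 : N * K * r2 <= 14 * N ^+ 3 * D * M3 * Q.
  apply: (@le_trans _ _ (N * (K * (1 + L) ^+ 2) * Q)).
    have -> : N * (K * (1 + L) ^+ 2) * Q = N * K * ((1 + L) ^+ 2 * Q) by ring.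
    by rewrite ler_wpM2l // mulr_ge0 // ltW.
  rewrite ler_wpM2r //.
  have -> : 14 * N ^+ 3 * D * M3 = N ^+ 3 * (14 * D * M3) by ring.
  exact: ler_pM (ltW nn0) (mulr_ge0 K0 (sqr_ge0 _)) N3 b1.
by lra.
Qed.

(** Arithmetic for SANA: the constraint removes the mean of the [alpha_i], but the gain controls
    only [mu * r2]. This accounts for the cube in the rate: two factors [mu] are absorbed by the
    bound on [p], and the third matches [mu * r2]. *)
Lemma constrained_rate (n : nat) (p r2 B Q : R) : (0 < n)%N ->
  0 <= p -> 0 <= r2 -> 
  mu ^+ 2 * p <= 2 * (r2 / n%:R) -> B <= 2 * n%:R * L ^+ 2 * p + 2 * r2 ->
  mu * r2 <= (1 + L) ^+ 2 * Q ->
  m / (14 * n%:R ^+ 3 * D * M3) * (L * p + B) <= Q / n%:R.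
Proof.
move=> n0 p0 r0 hp hB hQ.
have n1 : 1 <= n%:R :> R by rewrite ler1n.
have nn0 : 0 < n%:R :> R by rewrite ltr0n.
have M30 : 0 < M3 by exact: lt_le_trans M3_ge1.
have D0 : 0 < D by rewrite exprn_gt0 // ltr_wpDr // exprn_ge0 // ltW.
have Z0 : 0 < 14 * n%:R ^+ 3 * D * M3.
  by do 3 (apply: mulr_gt0 => //); exact: exprn_gt0.
rewrite ler_pdivlMr // (mulrAC m) (mulrAC (m * _)) ler_pdivrMr //.
move: n%:R n1 nn0 hp hB Z0 => N n1 nn0 hp hB Z0.
set s := r2 / N in hp.
have rs : r2 = N * s by rewrite /s mulrC divfK // gt_eqF.
have s0 : 0 <= s by rewrite divr_ge0 // ltW.
clearbody s.
have L2 : 0 <= L ^+ 2 by rewrite exprn_ge0 // ltW.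
have LL : 2 * L <= 1 + L ^+ 2 by have := sqr_ge0 (L - 1); lra.
have Q0 : 0 <= Q.
  rewrite -(pmulr_rge0 _ (_ : 0 < (1 + L) ^+ 2)) ?exprn_gt0 ?addr_gt0 //.
  by apply: le_trans hQ; rewrite mulr_ge0 // ltW.
have m3 : m <= mu ^+ 3 by rewrite /m ge_min lexx orbT.
have mp : m * p <= mu * (2 * s).
  apply: (@le_trans _ _ (mu ^+ 3 * p)); first by rewrite ler_wpM2r.
  by rewrite exprS -mulrA ler_pM2l.
have mr : m * r2 <= mu * r2 by rewrite ler_wpM2r // (le_trans m_le_c).
(* [K] bounds [2 L + 4 L^2 + 2], again by [2 L <= 1 + L^2]. *)
pose K := 3 + 5 * L ^+ 2.
have X : m * (L * p + B) <= K * (mu * r2).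
  have h0 : m * B <= m * (2 * N * L ^+ 2 * p + 2 * r2) by rewrite ler_pM2l.
  have h1 := ler_wpM2l (_ : 0 <= L + 2 * N * L ^+ 2) mp.
  have {}h1 := h1 _.
  have h2 : (L + 2 * N * L ^+ 2) * (mu * (2 * s))
      <= (2 * L + 4 * L ^+ 2) * (mu * r2).
    rewrite rs.
    have -> : (L + 2 * N * L ^+ 2) * (mu * (2 * s))
      = (2 * L + 4 * N * L ^+ 2) * (mu * s) by ring.
    have -> : (2 * L + 4 * L ^+ 2) * (mu * (N * s))
      = (2 * N * L + 4 * N * L ^+ 2) * (mu * s) by ring.
    rewrite ler_wpM2r ?mulr_ge0 ?(ltW mu_gt0) //.
    by have := ler_wpM2r (ltW L_gt0) n1; lra.
  have h3 : (2 * L + 4 * L ^+ 2 + 2) * (mu * r2) <= K * (mu * r2).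
    by rewrite ler_wpM2r ?mulr_ge0 ?(ltW mu_gt0) // /K; lra.
  have {}h1 : (L + 2 * N * L ^+ 2) * (m * p)
      <= (L + 2 * N * L ^+ 2) * (mu * (2 * s)).
    by apply: h1; rewrite addr_ge0 ?mulr_ge0 // ltW.
  lra.
have K0 : 0 <= K by rewrite addr_ge0 // mulr_ge0.
have hK : K <= (7 + 7 * L ^+ 2) * 2 by rewrite /K; lra.
have b1 := D_M3 K0 hK.
have N3 : N <= N ^+ 3 by rewrite exprS ler_peMr ?(ltW nn0) // exprn_ege1.
have -> : m * (L * p + B) * N = N * (m * (L * p + B)) by ring.
apply: le_trans (ler_wpM2l (ltW nn0) X) _.
apply: (@le_trans _ _ (N * (K * (1 + L) ^+ 2) * Q)).
  have -> : N * (K * (1 + L) ^+ 2) * Q = N * (K * ((1 + L) ^+ 2 * Q)) by ring.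
  by rewrite ler_pM2l // ler_wpM2l.
rewrite mulrC; apply: ler_wpM2l => //.
have -> : 14 * N ^+ 3 * D * M3 = N ^+ 3 * (14 * D * M3) by ring.
exact: ler_pM (ltW nn0) (mulr_ge0 K0 (sqr_ge0 _)) N3 b1.
Qed.

(** [t] is the squared distance of [w] to the minimizer and [E] the mean surrogate value. Of the
    three factors [c] in [m], two turn [t] into [p], and the third gives [p] its weight in the
    energy. The 18 is 9 times the 2 in front of [E]. *)
Lemma error_constant (n : nat) (p t B e E : R) : (0 < n)%N ->
  0 <= p -> 0 <= t -> 0 <= B -> mu ^+ 2 * t <= L ^+ 2 * p ->
  e <= (1 + 2 * n%:R * L ^+ 2) * t + 4 * n%:R * L ^+ 2 * p + 4 * B ->
  c * p + B <= 2 * E ->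
  e <= 18 * n%:R ^+ 2 * (M2 * D / m) * E.
Proof.
move=> n0 p0 t0 B0 ht he hE.
have n1 : 1 <= n%:R :> R by rewrite ler1n.
have nn0 : 0 < n%:R :> R by rewrite ltr0n.
apply: le_trans he _.
have -> : 18 * n%:R ^+ 2 * (M2 * D / m) * E
  = (9 * n%:R ^+ 2 * M2 * D * (2 * E)) / m.
  by field; rewrite gt_eqF.
rewrite ler_pdivlMr //.
move: n%:R n1 nn0 => N n1 nn0.
have L2 : 0 <= L ^+ 2 by rewrite exprn_ge0 // ltW.
have L4 : 0 <= L ^+ 4 by rewrite exprn_ge0 // ltW.
have D0 : 0 <= D by rewrite exprn_ge0 // addr_ge0.
have mt : m * t <= L ^+ 2 * (c * p).
  have -> : m * t = c * (c ^+ 2 * t) by rewrite mE; ring.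
  rewrite [leRHS]mulrCA ler_pM2l //; apply: le_trans ht.
  by rewrite ler_wpM2r.
have mp : m * p <= c * p by rewrite ler_wpM2r.
have mB : m * B <= B by rewrite ler_piMl // (le_trans m_le_c).
have cp0 : 0 <= c * p by rewrite mulr_ge0 // ltW.
have -> : ((1 + 2 * N * L ^+ 2) * t + 4 * N * L ^+ 2 * p + 4 * B) * m
  = (1 + 2 * N * L ^+ 2) * (m * t) + 4 * N * L ^+ 2 * (m * p) + 4 * (m * B) by ring.
have h1 : (1 + 2 * N * L ^+ 2) * (m * t)
    <= (1 + 2 * N * L ^+ 2) * (L ^+ 2 * (c * p)).
  by rewrite ler_wpM2l // addr_ge0 // !mulr_ge0 // ltW.
have h2 : 4 * N * L ^+ 2 * (m * p) <= 4 * N * L ^+ 2 * (c * p).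
  by rewrite ler_wpM2l // !mulr_ge0 // ltW.
have NN : N <= N ^+ 2 by rewrite expr2 ler_peMl // ltW.
have N2 : 1 <= N ^+ 2 by exact: le_trans NN.
have h3 : 9 * N ^+ 2 * D * (c * p + B) <= 9 * N ^+ 2 * M2 * D * (2 * E).
  have N9 : 0 <= 9 * N ^+ 2 by rewrite mulr_ge0 // exprn_ge0 // ltW.
  apply: ler_pM => //; [exact: mulr_ge0|exact: addr_ge0|].
  by apply: ler_wpM2r => //; rewrite ler_peMr.
have h4 : ((1 + 2 * N * L ^+ 2) * L ^+ 2 + 4 * N * L ^+ 2) * (c * p)
   <= 9 * N ^+ 2 * D * (c * p).
  rewrite ler_wpM2r //.
  apply: (@le_trans _ _ (N ^+ 2 * (5 * L ^+ 2 + 2 * L ^+ 4))).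
    have := ler_wpM2r L2 NN; have := ler_wpM2r L4 NN; have := ler_wpM2r L2 N2.
    lra.
  have : 5 * L ^+ 2 + 2 * L ^+ 4 <= 9 * D by rewrite /D; lra.
  by move=> h; have := ler_wpM2l (le_trans ler01 N2) h; lra.
have h5 : 4 * B <= 9 * N ^+ 2 * D * B.
  rewrite ler_wpM2r //.
  have : 4 <= 9 * D by rewrite /D; lra.
  by move=> h; have := ler_pM (ltW (ltr0Sn R 3)) ler01 h N2; lra.
lra.
Qed.

Lemma rate_ge0 (n : nat) : 0 <= m / (14 * n%:R ^+ 3 * D * M3).
Proof.
rewrite divr_ge0 ?(ltW m_gt0) // mulr_ge0 ?(le_trans ler01 M3_ge1) //.
by apply: mulr_ge0; [rewrite mulr_ge0 // exprn_ge0|exact: sqr_ge0].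
Qed.

Lemma rate_le1 (n : nat) : (0 < n)%N -> m / (14 * n%:R ^+ 3 * D * M3) <= 1.
Proof.
move=> n0.
have n1 : 1 <= n%:R ^+ 3 :> R by rewrite exprn_ege1 // ler1n.
have L2 : 0 <= L ^+ 2 by rewrite exprn_ge0 // ltW.
have D1 : 1 <= D by rewrite exprn_ege1 // -[leLHS]addr0 lerD // ler1n.
have Z1 : 1 <= 14 * n%:R ^+ 3 * D * M3.
  by do 3 (apply: mulr_ege1 => //); rewrite ler1n.
rewrite ler_pdivrMr ?mul1r; last exact: lt_le_trans Z1.
by apply: le_trans Z1; apply: le_trans c_le1.
Qed.

End Scalars.

(** * The steps of SAN and SANA *)

Lemma sum_option (V : nmodType) (I : finType) (F : option I -> V) :
  \sum_c F c = F None + \sum_i F (Some i).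
Proof.
rewrite (bigD1 None) //=; congr (_ + _).
rewrite (reindex_omap Some id) => [|[i|]] //=.
by apply: eq_bigl => i; rewrite eqxx.
Qed.

(** Purpose of the value [1 / (n + 1)]: as [1 - 1 / (n + 1) = n / (n + 1)], a Newton step weighs as
    much as the averaging step, and the law factors out of sums over choices. *)
Lemma SAN_law_uniform (R : realType) (n : nat) (c : option 'I_n) : (0 < n)%N ->
  SAN_law n.+1%:R^-1 c = n.+1%:R^-1 :> R.
Proof.
move=> n_gt0; case: c => [j|] //=; rewrite -natr1; field.
by rewrite natr1 !pnatr_eq0 /= -lt0n.
Qed.

Section Methods.
Context {R : realType} {n d : nat}.
Variables (f : 'I_n -> 'cV[R]_d -> R) (mu L : R).
Hypotheses (n_gt0 : (0 < n)%N) (mu_gt0 : 0 < mu) (mu_le_L : mu <= L).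
Hypothesis f_C2 : forall i, class_C2 (f i).
Hypothesis f_sc : forall i, strongly_convex mu (f i).
Hypothesis f_lip : forall i, lipschitz_grad L (f i).
Implicit Types (x y v : pt R n d).

Local Notation N := (newton_dir f).
Local Notation H i x := (hess (f i) (wpart x)).

Let L_gt0 : 0 < L. Proof. exact: lt_le_trans mu_le_L. Qed.

Definition residual x i : 'cV[R]_d := grad (f i) (wpart x) - apart x i.
Definition tail_sqr v : R := \sum_i dot (apart v i) (apart v i).
Definition residual_sqr x : R := \sum_i dot (residual x i) (residual x i).

Let nE : n%:R != 0 :> R. Proof. by rewrite pnatr_eq0 -lt0n. Qed.
Let nR_gt0 : 0 < n%:R :> R. Proof. by rewrite ltr0n. Qed.

Let hess_lo i (w u : 'cV[R]_d) : mu * dot u u <= dot (hess (f i) w *m u) u.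
Proof. exact: hess_coercive. Qed.
Let hess_hi i (w u : 'cV[R]_d) :
  dot (hess (f i) w *m u) (hess (f i) w *m u) <= L ^+ 2 * dot u u.
Proof. exact: hess_bounded. Qed.

Let apart_N x i : apart (N x) i = H i x *m wpart (N x) - residual x i.
Proof. exact: (apart_newton_dir n_gt0 f_C2 mu_gt0 f_sc). Qed.

Let sum_apart_N x : \sum_i apart (N x) i = \sum_i apart x i.
Proof. exact: (sum_apart_newton_dir n_gt0 f_C2 mu_gt0 f_sc). Qed.

Let sum_const (I : finType) (a : R) : \sum_(i : I) a = #|I|%:R * a.
Proof. by rewrite sumr_const mulr_natl. Qed.

Lemma tail_newton_le x :
  tail_sqr (N x) <=
    2 * n%:R * L ^+ 2 * dot (wpart (N x)) (wpart (N x)) + 2 * residual_sqr x.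
Proof.
have -> : 2 * n%:R * L ^+ 2 * dot (wpart (N x)) (wpart (N x)) =
    \sum_(i < n) 2 * (L ^+ 2 * dot (wpart (N x)) (wpart (N x))).
  by rewrite sum_const card_ord; ring.
rewrite [2 * residual_sqr x]mulr_sumr -big_split /=; apply: ler_sum => i _.
rewrite apart_N; apply: le_trans (dot_sqrB_le _ _) _.
by rewrite lerD2r ler_pM2l.
Qed.

Lemma mean_hess_newton x :
  n%:R^-1 *: \sum_i (H i x *m wpart (N x)) =
  n%:R^-1 *: \sum_i apart x i + n%:R^-1 *: \sum_i residual x i.
Proof.
rewrite -scalerDr; congr (_ *: _); rewrite -sum_apart_N -big_split /=.
by apply: eq_bigr => i _; rewrite apart_N subrK.
Qed.

(** The mean of the Hessians is [mu]-coercive, so [mu |N_0|] is at most the norm of the mean of the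
    [H_i N_0]; that mean is split by [mean_hess_newton], and Jensen bounds its residual part. *)
Lemma wpart_newton_le x :
  mu ^+ 2 * dot (wpart (N x)) (wpart (N x)) <=
    2 * dot (n%:R^-1 *: \sum_i apart x i) (n%:R^-1 *: \sum_i apart x i)
    + 2 * (residual_sqr x / n%:R).
Proof.
apply: (@le_trans _ _ (dot (n%:R^-1 *: \sum_i (H i x *m wpart (N x)))
                           (n%:R^-1 *: \sum_i (H i x *m wpart (N x))))).
  apply: coercive_dot_sqr; first exact: ltW.
  rewrite dotZl dot_suml ler_pdivlMl // -[n in n%:R]card_ord -sum_const.
  by apply: ler_sum => i _; exact: hess_lo.
rewrite mean_hess_newton; apply: le_trans (dot_sqrD_le _ _) _.
rewrite lerD2l ler_pM2l // ler_pdivlMr // mulrC.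
exact: dot_mean_le.
Qed.

Lemma shifted_hess_unit (a : R) i (w : 'cV[R]_d) : 0 <= a ->
  a%:M + hess (f i) w \in unitmx.
Proof.
move=> a0; apply: unitmx_inj_col => v v0.
apply: dot_eq0; apply/eqP; rewrite eq_le dot_ge0 andbT.
rewrite -(pmulr_rle0 _ mu_gt0); apply: le_trans (hess_lo i w v) _.
have : dot ((a%:M + hess (f i) w) *m v) v = 0 by rewrite v0 dot0l.
rewrite mulmxDl mul_scalar_mx dotDl dotZl => /eqP.
by rewrite addrC addr_eq0 => /eqP ->; rewrite oppr_le0 mulr_ge0 // dot_ge0.
Qed.

(** This is [- d^k], with [a = 1] for SAN and [a = 1 - 1/n] for SANA. *)
Definition newton_step (a : R) x j : 'cV[R]_d :=
  invmx (a%:M + H j x) *m residual x j.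

Lemma newton_stepE (a : R) x j : 0 <= a ->
  a *: newton_step a x j + H j x *m newton_step a x j = residual x j.
Proof.
by move=> a0; rewrite -mul_scalar_mx -mulmxDl mulKVmx // shifted_hess_unit.
Qed.

Lemma newton_step_coercive (a : R) x j : 0 <= a ->
  (a + mu) * dot (newton_step a x j) (newton_step a x j)
    <= dot (residual x j) (newton_step a x j).
Proof.
move=> a0; rewrite -(newton_stepE x j a0) dotDl dotZl mulrDl lerD2l.
exact: hess_lo.
Qed.

(** Expand the square of [a e + H e], where [H] has norm at most [L] and [a <= 1]. *)
Lemma residual_le_newton_step (a : R) x j : 0 <= a <= 1 ->
  dot (residual x j) (residual x j)
    <= (1 + L) ^+ 2 * dot (newton_step a x j) (newton_step a x j).
Proof.
move=> /andP[a0 a1]; rewrite -{1 2}(newton_stepE x j a0).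
move: (newton_step a x j) => e.
have h1 := hess_hi j (wpart x) e.
have h2 := dot_le_of_sqr_le L_gt0 h1.
rewrite !(dotDl, dotDr, dotZl, dotZr) (dotC e (_ *m e)).
have e0 := dot_ge0 e.
have h3 : a * dot (H j x *m e) e <= L * dot e e.
  apply: le_trans (ler_wpM2l a0 h2) _.
  by rewrite ler_piMl // mulr_ge0 // ltW.
have h4 : a * (a * dot e e) <= dot e e.
  rewrite mulrA ler_piMl // -[leRHS]mulr1.
  by apply: ler_pM.
lra.
Qed.

Lemma Wnewton_form x j : dot (Wnewton f x j *m N x) (N x) =
  dot (H j x *m wpart (N x)) (wpart (N x)) + tail_sqr (N x).
Proof.
rewrite dot_blocks wpart_Wnewton; congr (_ + _).
by apply: eq_bigr => i _; rewrite apart_Wnewton.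
Qed.

(** The equalities on [q] hold when [y - x] is [- gamma] times a [W]-orthogonal projection of [N] of
    squared norm [q]. At [z = y] and [K = 1 / gamma] the linear term contributes [- gamma q] and the
    quadratic one [gamma q / 2]. *)
Lemma surrogate_descent x y (W W' : ptmx R n d) (gamma K q : R) :
  W \in unitmx -> W^T = W -> 0 < K -> gamma = 1 / K ->
  dot (W *m N x) (y - x) = - (gamma * q) ->
  dot (W *m (y - x)) (y - x) = gamma ^+ 2 * q ->
  (forall z, surrogate f y W' z <= surrogate f x W x
     + dot (grad (surrogate f x W) x) (z - x) + K / 2 * sqnormM W (z - x)) ->
  surrogate f y W' y <= surrogate f x W x - gamma / 2 * q.
Proof.
move=> uW sW K0 gK e1 e2 /(_ y) h; apply: le_trans h _.
rewrite (dot_grad_surrogate n_gt0 f_C2 mu_gt0 f_sc) // /sqnormM e1 e2 gK.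
rewrite le_eqVlt; apply/orP; left; apply/eqP; field.
by rewrite gt_eqF.
Qed.

Let apart_sum_dot x v u (F : 'I_n -> R) :
  (forall i, apart v i = F i *: u) ->
  \sum_i dot (apart x i) (apart v i) = dot (\sum_i F i *: apart x i) u.
Proof.
move=> e; rewrite dot_suml; apply: eq_bigr => i _.
by rewrite e dotZl dotZr.
Qed.

(** * The SAN step as a projection, its rate and its energy *)

Section SAN.
Variable gamma : R.

(* Squared [W]-norm of the [W]-orthogonal projection of [newton_dir f x] on the
   sampled subspace; the step is [- gamma] times this projection. *)
Definition SAN_gain x (c : option 'I_n) : R :=
  if c is Some j then dot (residual x j) (newton_step 1 x j)
  else n%:R * dot (n%:R^-1 *: \sum_i apart x i) (n%:R^-1 *: \sum_i apart x i).

Let wpart_avg x : wpart (SAN_step f gamma x None - x) = 0.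
Proof. by rewrite linearB /= wpart_stack subrr. Qed.

Let apart_avg x i : apart (SAN_step f gamma x None - x) i =
  - gamma *: (n%:R^-1 *: \sum_i apart x i).
Proof.
by rewrite apartB apart_stack addrAC subrr add0r -scalerA scaleNr.
Qed.

Let wpart_newton x j :
  wpart (SAN_step f gamma x (Some j) - x) = - gamma *: newton_step 1 x j.
Proof. by rewrite linearB /= wpart_stack addrAC subrr add0r scalerN scaleNr. Qed.

Let apart_newton x j i : apart (SAN_step f gamma x (Some j) - x) i =
  (gamma *+ (i == j)) *: newton_step 1 x j.
Proof.
rewrite apartB apart_stack; case: eqP => _; last by rewrite subrr scale0r.
by rewrite addrAC subrr add0r scalerN opprK mulr1n.
Qed.

Let sum_pick x j (a : R) :
  \sum_i (a *+ (i == j)) *: apart x i = a *: apart x j.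
Proof.
rewrite (bigD1 j) //= eqxx mulr1n big1 ?addr0 // => i /negPf ->.
by rewrite mulr0n scale0r.
Qed.

(** In a Newton step only [w] and [alpha_j] move, by [- gamma e] and [gamma e]; since
    [N_j = H_j N_0 - r_j], the Hessian terms cancel. The averaging step uses that [N] and [x] have
    the same sum of [alpha] blocks. *)
Lemma SAN_step_inner x c :
  dot (SAN_W f x c *m N x) (SAN_step f gamma x c - x) = - (gamma * SAN_gain x c).
Proof.
case: c => [j|]; rewrite dot_blocks /SAN_W /SAN_gain.
  rewrite wpart_Wnewton wpart_newton.
  under eq_bigr do rewrite apart_Wnewton.
  rewrite (@apart_sum_dot _ _ (newton_step 1 x j) (fun i => gamma *+ (i == j)))
    => [|i]; last exact: apart_newton.
  rewrite sum_pick apart_N dotZr dotZl dotBl; ring.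
rewrite mul1mx wpart_avg dot0r add0r.
rewrite (@apart_sum_dot _ _ (n%:R^-1 *: \sum_i apart x i) (fun=> - gamma))
  => [|i]; last exact: apart_avg.
rewrite -scaler_sumr sum_apart_N !dotZl !dotZr; field.
exact: nE.
Qed.

(** The equation [e + H_j e = r_j] of the Newton step turns [<H_j e, e> + <e, e>] into the gain. *)
Lemma SAN_step_sqr x c :
  dot (SAN_W f x c *m (SAN_step f gamma x c - x)) (SAN_step f gamma x c - x)
  = gamma ^+ 2 * SAN_gain x c.
Proof.
case: c => [j|]; rewrite dot_blocks /SAN_W /SAN_gain.
  rewrite wpart_Wnewton wpart_newton.
  under eq_bigr do rewrite apart_Wnewton apart_newton.
  rewrite (bigD1 j) //= eqxx big1 => [|i /negPf ->]; last first.
    by rewrite mulr0n scale0r dot0l.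
  rewrite addr0 mulr1n -(newton_stepE x j ler01) -scalemxAr.
  rewrite !(dotDl, dotZl, dotZr); ring.
rewrite mul1mx wpart_avg dot0r add0r.
under eq_bigr do rewrite apart_avg.
rewrite sum_const card_ord dotZl dotZr; ring.
Qed.

Lemma SAN_rate x :
  Num.min 1 (mu ^+ 3) / (14 * n%:R ^+ 3 * (2 + L ^+ 2) ^+ 2 * Num.max 1 (L ^+ 3))
    * \sum_c SAN_law (n.+1%:R^-1) c * dot (SAN_W f x c *m N x) (N x)
  <= \sum_c SAN_law (n.+1%:R^-1) c * SAN_gain x c.
Proof.
under eq_bigr do rewrite SAN_law_uniform //.
under [leRHS]eq_bigr do rewrite SAN_law_uniform //.
rewrite -!mulr_sumr mulrCA ler_pM2l ?invr_gt0 ?ltr0n // !sum_option /=.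
set p := dot (wpart (N x)) (wpart (N x)).
have p0 : 0 <= p := dot_ge0 _.
have bound : dot (1%:M *m N x) (N x) + \sum_i dot (Wnewton f x i *m N x) (N x)
    <= (1 + n%:R * L) * p + n.+1%:R * tail_sqr (N x).
  rewrite mul1mx dot_blocks -/p -/(tail_sqr (N x)).
  have : \sum_i dot (Wnewton f x i *m N x) (N x)
      <= \sum_(i < n) (L * p + tail_sqr (N x)).
    apply: ler_sum => i _; rewrite Wnewton_form lerD2r.
    exact: dot_le_of_sqr_le.
  rewrite sum_const card_ord -natr1; lra.
apply: le_trans (ler_wpM2l (rate_ge0 L mu_gt0 n) bound) _.
apply: (sum_rate mu_gt0 mu_le_L n_gt0 p0 _ _
  (wpart_newton_le x) (tail_newton_le x)).
- by apply: sumr_ge0 => i _; exact: dot_ge0.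
- exact: dot_ge0.
rewrite mulr_sumr; apply: ler_sum => j _.
have := residual_le_newton_step x j (_ : 0 <= 1 <= 1).
rewrite ler01 lexx => /(_ isT) h; apply: le_trans h _.
rewrite ler_wpM2l ?sqr_ge0 //.
(* Here [a = 1], so the coercivity constant [1 + mu] is at least 1 and no factor [mu] is lost. *)
have := newton_step_coercive x j ler01; apply: le_trans.
by rewrite ler_peMl ?dot_ge0 // lerDl ltW.
Qed.

(** The averaging choice has [W = I] and gives [N_0] weight 1, each Newton choice gives it at least
    [mu]; hence the minimum. *)
Lemma SAN_energy_ge x :
  Num.min 1 mu * dot (wpart (N x)) (wpart (N x)) + tail_sqr (N x)
  <= \sum_c SAN_law (n.+1%:R^-1) c * dot (SAN_W f x c *m N x) (N x).
Proof.
under eq_bigr do rewrite SAN_law_uniform //.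
rewrite -mulr_sumr ler_pdivlMl ?ltr0n // sum_option /=.
rewrite mul1mx dot_blocks -/(tail_sqr (N x)).
set p := dot (wpart (N x)) (wpart (N x)).
have p0 : 0 <= p := dot_ge0 _.
have : \sum_(i < n) (Num.min 1 mu * p + tail_sqr (N x))
    <= \sum_i dot (Wnewton f x i *m N x) (N x).
  apply: ler_sum => i _; rewrite Wnewton_form lerD2r.
  apply: le_trans (hess_lo _ _ _); rewrite ler_wpM2r // ge_min lexx orbT //.
have : Num.min 1 mu * p <= p by rewrite ler_piMl // ge_min lexx.
rewrite sum_const card_ord -natr1; lra.
Qed.

End SAN.

(** * The SANA step as a projection, its rate and its energy *)

Section SANA.
Variable gamma : R.
Let a : R := 1 - n%:R^-1.

Let a_bounds : 0 <= a <= 1.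
Proof.
by rewrite subr_ge0 invf_le1 // ler1n n_gt0 gerBl invr_ge0 ltW.
Qed.

Definition SANA_gain x (j : 'I_n) : R := dot (residual x j) (newton_step a x j).

Let wpart_step x j :
  wpart (SANA_step f gamma x j - x) = - gamma *: newton_step a x j.
Proof. by rewrite linearB /= wpart_stack addrAC subrr add0r scalerN scaleNr. Qed.

Let apart_step x j i : apart (SANA_step f gamma x j - x) i =
  (gamma *+ (i == j) - gamma / n%:R) *: newton_step a x j.
Proof.
rewrite apartB apart_stack /newton_step; case: eqP => _.
  by rewrite addrAC subrr add0r scalerN opprK mulr1n mulrBr mulr1.
by rewrite addrAC subrr add0r scalerN -scaleNr mulr0n sub0r.
Qed.

(** The increments have coefficient [gamma - gamma / n] once and [- gamma / n] at the other [n - 1]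
    indices, which add up to zero. *)
Lemma SANA_step_sum x j :
  \sum_i apart x i = 0 -> \sum_i apart (SANA_step f gamma x j) i = 0.
Proof.
move=> s0; have : \sum_i apart (SANA_step f gamma x j - x) i = 0.
  under eq_bigr do rewrite apart_step.
  rewrite -scaler_suml sumrB (bigD1 j) //= eqxx mulr1n.
  rewrite big1 => [|i /negPf ->]; last by rewrite mulr0n.
  rewrite sum_const card_ord addr0 mulrC divfK ?nE // subrr scale0r //.
under eq_bigr do rewrite apartB.
by rewrite sumrB s0 subr0.
Qed.

(** Besides a move of SAN type, all [alpha_i] are shifted by a common vector; the shift contributes
    nothing because the [alpha] blocks of [N] sum to zero along with those of [x]. *)
Lemma SANA_step_inner x j : \sum_i apart x i = 0 ->
  dot (Wnewton f x j *m N x) (SANA_step f gamma x j - x)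
  = - (gamma * SANA_gain x j).
Proof.
move=> s0; rewrite dot_blocks wpart_Wnewton wpart_step.
under eq_bigr do rewrite apart_Wnewton.
rewrite (@apart_sum_dot _ _ (newton_step a x j)
  (fun i => gamma *+ (i == j) - gamma / n%:R)) => [|i]; last exact: apart_step.
under eq_bigr do rewrite scalerBl.
rewrite sumrB -scaler_sumr sum_apart_N s0 scaler0 subr0.
rewrite (bigD1 j) //= eqxx mulr1n big1 => [|i /negPf ->]; last first.
  by rewrite mulr0n scale0r.
rewrite addr0 apart_N dotZr dotZl dotBl /SANA_gain; ring.
Qed.

Lemma SANA_step_sqr x j :
  dot (Wnewton f x j *m (SANA_step f gamma x j - x)) (SANA_step f gamma x j - x)
  = gamma ^+ 2 * SANA_gain x j.
Proof.
have a0 : 0 <= a by case/andP: a_bounds.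
rewrite dot_blocks wpart_Wnewton wpart_step.
under eq_bigr do rewrite apart_Wnewton apart_step dotZl dotZr.
rewrite /SANA_gain -(newton_stepE x j a0) -scalemxAr dotZl dotZr dotDl dotZl.
move: (dot _ _) (dot (newton_step a x j) _) => h e.
(* The squared coefficients give [(1 - 1/n)^2 + (n - 1) / n^2 = 1 - 1/n], which matches the shift
   [a] of the Hessian in SANA. *)
have -> : \sum_i (gamma *+ (i == j) - gamma / n%:R)
      * ((gamma *+ (i == j) - gamma / n%:R) * e)
    = gamma ^+ 2 * (a * e).
  rewrite (bigD1 j) //= eqxx mulr1n.
  rewrite (eq_bigr (fun=> (gamma / n%:R) ^+ 2 * e)); last first.
    by move=> i /negPf ->; rewrite mulr0n; ring.
  rewrite sumr_const cardC1 card_ord -[X in _ + X]mulr_natl.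
  rewrite (_ : n.-1%:R = n%:R - 1); last by rewrite -subn1 natrB.
  rewrite /a; field.
  exact: nE.
ring.
Qed.

Lemma SANA_rate x : \sum_i apart x i = 0 ->
  Num.min 1 (mu ^+ 3) / (14 * n%:R ^+ 3 * (2 + L ^+ 2) ^+ 2 * Num.max 1 (L ^+ 3))
    * \sum_j n%:R^-1 * dot (Wnewton f x j *m N x) (N x)
  <= \sum_j n%:R^-1 * SANA_gain x j.
Proof.
move=> s0; rewrite -[leRHS]mulr_sumr [leRHS]mulrC.
set p := dot (wpart (N x)) (wpart (N x)).
have p0 : 0 <= p := dot_ge0 _.
have bound : \sum_j n%:R^-1 * dot (Wnewton f x j *m N x) (N x)
    <= L * p + tail_sqr (N x).
  rewrite -mulr_sumr ler_pdivrMl // -[n in n%:R]card_ord -sum_const.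
  apply: ler_sum => i _; rewrite Wnewton_form lerD2r.
  exact: dot_le_of_sqr_le.
apply: le_trans (ler_wpM2l (rate_ge0 L mu_gt0 n) bound) _.
have := wpart_newton_le x; rewrite s0 scaler0 dot0l mulr0 add0r => hp.
apply: (constrained_rate mu_gt0 mu_le_L n_gt0 p0 _ hp (tail_newton_le x)).
  by apply: sumr_ge0 => i _; exact: dot_ge0.
rewrite !mulr_sumr; apply: ler_sum => j _.
have h := ler_wpM2l (ltW mu_gt0) (residual_le_newton_step x j a_bounds).
apply: le_trans h _; rewrite mulrCA ler_wpM2l ?sqr_ge0 //.
have a0 : 0 <= a by case/andP: a_bounds.
(* [a] vanishes when [n = 1], so only [mu] is kept of the constant [a + mu]. *)
have := newton_step_coercive x j a0; apply: le_trans.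
by rewrite ler_wpM2r ?dot_ge0 // lerDr.
Qed.

Lemma SANA_energy_ge x :
  Num.min 1 mu * dot (wpart (N x)) (wpart (N x)) + tail_sqr (N x)
  <= \sum_j n%:R^-1 * dot (Wnewton f x j *m N x) (N x).
Proof.
rewrite -mulr_sumr ler_pdivlMl // -[n in n%:R]card_ord -sum_const.
apply: ler_sum => i _; rewrite Wnewton_form lerD2r.
apply: le_trans (hess_lo _ _ _).
by rewrite ler_wpM2r ?dot_ge0 // ge_min lexx orbT.
Qed.

End SANA.

(** * Distance to the solution in terms of the Newton direction *)

Variable wstar : 'cV[R]_d.
Hypothesis wstar_argmin : forall w : 'cV[R]_d,
  n%:R^-1 * (\sum_i f i wstar) <= n%:R^-1 * (\sum_i f i w).

Definition error x : R :=
  enorm (wpart x - wstar) ^+ 2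
  + \sum_i enorm (apart x i - grad (f i) wstar) ^+ 2.

Lemma sum_grad_wstar : \sum_i grad (f i) wstar = 0.
Proof.
have df i w : differentiable (f i) w by case: (f_C2 i).
have -> : \sum_i grad (f i) wstar = grad (\sum_i f i) wstar.
  apply/matrixP => k l; rewrite summxE mxE derive_sum => [|i].
    by apply: eq_bigr => i _; rewrite mxE.
  exact: diff_derivable.
apply: grad_at_min; first exact: differentiable_sum.
move=> w; rewrite !fct_sumE.
by have := wstar_argmin w; rewrite ler_pM2l ?invr_gt0.
Qed.

(** The vector [g] is the gradient of the mean function at [w]: strong monotonicity against the zero
    gradient at [wstar] bounds it from below, Jensen and the Hessian bound from above. *)
Lemma wpart_error_le x :
  mu ^+ 2 * dot (wpart x - wstar) (wpart x - wstar)
    <= L ^+ 2 * dot (wpart (N x)) (wpart (N x)).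
Proof.
set g := n%:R^-1 *: \sum_i (H i x *m wpart (N x)).
have gE : g = n%:R^-1 *: \sum_i (grad (f i) (wpart x) - grad (f i) wstar).
  rewrite sumrB sum_grad_wstar subr0 /g mean_hess_newton -scalerDr.
  congr (_ *: _); rewrite -big_split /=; apply: eq_bigr => i _.
  by rewrite /residual addrC subrK.
apply: (@le_trans _ _ (dot g g)).
  apply: coercive_dot_sqr; first exact: ltW.
  rewrite gE dotZl dot_suml ler_pdivlMl // -[n in n%:R]card_ord -sum_const.
  apply: ler_sum => i _; apply: strongly_convex_monotone => //.
  by case: (f_C2 i).
rewrite -(ler_pM2l nR_gt0); apply: le_trans (dot_mean_le _ n_gt0) _.
rewrite -[n in n%:R]card_ord -sum_const.
by apply: ler_sum => i _; exact: hess_hi.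
Qed.

(** Each [alpha] error is [(grad f_i(w) - grad f_i(wstar)) - r_i] with [r_i = H_i N_0 - N_i]; both
    differences are bounded by the squared triangle inequality. *)
Lemma error_le x :
  error x <= (1 + 2 * n%:R * L ^+ 2) * dot (wpart x - wstar) (wpart x - wstar)
    + 4 * n%:R * L ^+ 2 * dot (wpart (N x)) (wpart (N x)) + 4 * tail_sqr (N x).
Proof.
rewrite /error enorm_sqr.
set t := dot _ _; set p := dot (wpart (N x)) _.
have : \sum_i enorm (apart x i - grad (f i) wstar) ^+ 2
    <= \sum_i (2 * (L ^+ 2 * t) + 4 * (L ^+ 2 * p)
               + 4 * dot (apart (N x) i) (apart (N x) i)).
  apply: ler_sum => i _; rewrite enorm_sqr.
  have -> : apart x i - grad (f i) wstar =
      (grad (f i) (wpart x) - grad (f i) wstar) - residual x i.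
    by rewrite /residual opprB [RHS]addrC addrA subrK.
  apply: le_trans (dot_sqrB_le _ _) _.
  have h1 : dot (grad (f i) (wpart x) - grad (f i) wstar)
      (grad (f i) (wpart x) - grad (f i) wstar) <= L ^+ 2 * t.
    have := f_lip i (wpart x) wstar.
    rewrite -(@ler_pXn2r _ 2) ?nnegrE ?sqrtr_ge0 //; last first.
      by rewrite mulr_ge0 ?sqrtr_ge0 // ltW.
    by rewrite exprMn !enorm_sqr.
  have h2 : dot (residual x i) (residual x i)
      <= 2 * (L ^+ 2 * p) + 2 * dot (apart (N x) i) (apart (N x) i).
    have -> : residual x i = H i x *m wpart (N x) - apart (N x) i.
      by rewrite apart_N opprB addrC subrK.
    apply: le_trans (dot_sqrB_le _ _) _.
    by rewrite lerD2r ler_pM2l.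
  lra.
rewrite !big_split /= !sum_const card_ord -mulr_sumr -/(tail_sqr _); lra.
Qed.

Lemma error_energy x (E : R) :
  Num.min 1 mu * dot (wpart (N x)) (wpart (N x)) + tail_sqr (N x) <= 2 * E ->
  error x <= 18 * n%:R ^+ 2 *
    (Num.max 1 (L ^+ 2) * (2 + L ^+ 2) ^+ 2 / Num.min 1 (mu ^+ 3)) * E.
Proof.
apply: (error_constant mu_gt0 mu_le_L n_gt0 _ _ _ (wpart_error_le x) (error_le x)).
- exact: dot_ge0.
- exact: dot_ge0.
- by apply: sumr_ge0 => i _; exact: dot_ge0.
Qed.

End Methods.

(** * Expected decay along trajectories *)

Section Trajectories.
Context {R : realType} {disp : measure_display} {T : measurableType disp}.
Context (P : probability T R) (I : finType) (law : I -> R) (xi : nat -> T -> I).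
Hypothesis iid : iid_choices P law xi.
Context (S : Type) (step : S -> I -> S) (x0 : S) (x : nat -> T -> S).
Hypothesis x_init : forall o, x 0%N o = x0.
Hypothesis x_step : forall k o, x k.+1 o = step (x k o) (xi k o).

Local Notation state := (foldl step x0).

Lemma trajectoryE k o : x k o = state (mkseq (xi ^~ o) k).
Proof. by elim: k => [|k IH]; rewrite ?x_init // x_step IH mkseqS foldl_rcons. Qed.

Lemma expectation_trajectory k (Phi : S -> R) : (forall s, 0 <= Phi s) ->
  ('E_P[fun o => Phi (x k o)] = (word_mean law k (fun c => Phi (state c)))%:E)%E.
Proof.
move=> Phi0; rewrite -(expectation_history iid) //.
by congr expectation; apply/funext => o; rewrite trajectoryE.
Qed.

Variables (V gain : S -> I -> R) (gamma rho : R).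
Hypothesis V_ge0 : forall s i, 0 <= V s i.

Lemma expectation_first :
  ('E_P[fun o => V (x 0%N o) (xi 0%N o)] = (\sum_i law i * V x0 i)%:E)%E.
Proof.
(* The value 0 at the empty word is a filler: only words of length one are averaged. *)
pose G c := if c is i :: _ then V x0 i else 0.
have -> : \sum_i law i * V x0 i = word_mean law 1 G.
  by rewrite word_meanS word_mean0.
rewrite -(expectation_history iid) => [|[|i c]] //; last exact: V_ge0.
by congr expectation; apply/funext => o; rewrite x_init.
Qed.

Hypothesis law_gt0 : forall i, 0 < law i.
Hypothesis law_sum : \sum_i law i = 1.
Hypothesis gamma_ge0 : 0 <= gamma.
Hypothesis rate_le1 : gamma * rho <= 1.
Hypothesis descent : forall k o,
  V (x k.+1 o) (xi k.+1 o)
    <= V (x k o) (xi k o) - gamma / 2 * gain (x k o) (xi k o).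
Hypothesis rate : forall k o,
  2 * rho * \sum_i law i * V (x k o) i <= \sum_i law i * gain (x k o) i.

Lemma expected_decay k (Phi : S -> R) (C : R) : 0 <= C ->
  (forall s, Phi s <= C * \sum_i law i * V s i) ->
  ((word_mean law k (fun c => Phi (state c)))%:E
   <= C%:E * 'E_P[fun o => V (x 0%N o) (xi 0%N o)]
      * ((1 - gamma * rho) ^+ k)%:E)%E.
Proof.
move=> C0 PhiV; have law_ge0 i : 0 <= law i by exact: ltW.
rewrite expectation_first -!EFinM lee_fin.
have h := word_mean_le law_ge0 k (fun c => PhiV (state c)).
apply: le_trans h _; rewrite word_meanZ -mulrA; apply: ler_wpM2l => //.
rewrite mulrC.
apply: (word_mean_decay law_ge0 (V := fun c => V (state c))
  (q := fun c => gain (state c))) => // [c i i'|c].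
  (* The potential at the next time involves the next choice, so the word to be realized has two
     letters beyond the history [c]. *)
  have [w wE] := history_realized iid (rcons (rcons c i) i') law_gt0.
  move: wE; rewrite !size_rcons !mkseqS => /rcons_inj [/rcons_inj [wc wi] wi'].
  have := descent (size c) w.
  by rewrite !trajectoryE mkseqS wc wi wi'.
have [w wE] := history_realized iid c law_gt0.
by have := rate (size c) w; rewrite trajectoryE wE.
Qed.

End Trajectories.

Theorem theorem4p9 (R : realType) (disp : measure_display)
    (T : measurableType disp) (P : probability T R)
    (n d : nat) (n_gt0 : (0 < n)%N)
    (f : 'I_n -> 'cV[R]_d -> R) (muf Lf : R)
    (muf_gt0 : 0 < muf) (muf_le_Lf : muf <= Lf)
    (f_C2 : forall i, class_C2 (f i))
    (f_sc : forall i, strongly_convex muf (f i))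
    (f_lip : forall i, lipschitz_grad Lf (f i))
    (wstar : 'cV[R]_d)
    (wstar_argmin : forall w : 'cV[R]_d,
      n%:R^-1 * (\sum_i f i wstar) <= n%:R^-1 * (\sum_i f i w))
    (gamma : R) (gamma_bounds : 0 < gamma <= 1)
    (x : nat -> T -> pt R n d) (W : nat -> T -> ptmx R n d)
    (gen : generated_by_SAN P f (n.+1%:R^-1) gamma x W
           \/ generated_by_SANA P f gamma x W)
    (L : R) (L_gt0 : 0 < L)
    (L_bound : forall (k : nat) (o : T) (y : pt R n d),
      surrogate f (x k.+1 o) (W k.+1 o) y <=
        surrogate f (x k o) (W k o) (x k o)
        + dot (grad (surrogate f (x k o) (W k o)) (x k o)) (y - x k o)
        + L / 2 * sqnormM (W k o) (y - x k o))
    (gamma_L : gamma = 1 / L) (k : nat) :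
  let rho : R := Num.min 1 (muf ^+ 3)
    / (14 * n%:R ^+ 3 * (2 + Lf ^+ 2) ^+ 2 * Num.max 1 (Lf ^+ 3)) in
  let C : \bar R :=
    ((18 * n%:R ^+ 2 * (Num.max 1 (Lf ^+ 2) * (2 + Lf ^+ 2) ^+ 2
        / Num.min 1 (muf ^+ 3)))%:E
     * 'E_P[fun o => surrogate f (x 0%N o) (W 0%N o) (x 0%N o)])%E in
  ('E_P[fun o => (enorm (wpart (x k o) - wstar) ^+ 2)%R]
   + \sum_(i < n)
       'E_P[fun o => (enorm (apart (x k o) i - grad (f i) wstar) ^+ 2)%R]
   <= C * ((1 - gamma * rho) ^+ k)%:E)%E.
Proof.
lazy zeta; case/andP: gamma_bounds => gamma_gt0 gamma_le1.
set rho := Num.min _ _ / (14 * _ * _ * _).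
set c0 := 18 * n%:R ^+ 2 * _; set C := (c0%:E * _)%E.
have muf3 : 0 < Num.min 1 (muf ^+ 3) by rewrite lt_min ltr01 exprn_gt0.
have c0_ge0 : 0 <= c0.
  apply: mulr_ge0; first by rewrite mulr_ge0 // exprn_ge0.
  by rewrite divr_ge0 ?(ltW muf3) // mulr_ge0 ?sqr_ge0 // le_max ler01.
have rho_le1 : rho <= 1 by exact: rate_le1.
have gr1 : gamma * rho <= 1.
  by apply: le_trans (ler_wpM2l (ltW gamma_gt0) rho_le1) _; rewrite mulr1.
have n0 : 0 < n%:R :> R by rewrite ltr0n.
(* The algorithms differ only in the law, step, matrix and gain, so their common argument is carried
   out once. The step identities and the rate are asked along the trajectory only, since those of
   SANA rely on an invariant. *)
have conclude (I : finType) (law : I -> R) (xi : nat -> T -> I)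
    (step : pt R n d -> I -> pt R n d) (x0 : pt R n d)
    (Wf : pt R n d -> I -> ptmx R n d) (gain : pt R n d -> I -> R) :
    iid_choices P law xi -> (forall o, x 0%N o = x0) ->
    (forall k o, x k.+1 o = step (x k o) (xi k o)) ->
    (forall k o, W k o = Wf (x k o) (xi k o)) ->
    (forall i, 0 < law i) -> \sum_i law i = 1 ->
    (forall y i, Wf y i \in unitmx) -> (forall y i, (Wf y i)^T = Wf y i) ->
    (forall y i, 0 <= dot (Wf y i *m newton_dir f y) (newton_dir f y)) ->
    (forall k o, let y := x k o in let i := xi k o in
      dot (Wf y i *m newton_dir f y) (step y i - y) = - (gamma * gain y i) /\
      dot (Wf y i *m (step y i - y)) (step y i - y) = gamma ^+ 2 * gain y i) ->
    (forall k o, rho * \sum_i law i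
        * dot (Wf (x k o) i *m newton_dir f (x k o)) (newton_dir f (x k o))
      <= \sum_i law i * gain (x k o) i) ->
    (forall y, Num.min 1 muf
        * dot (wpart (newton_dir f y)) (wpart (newton_dir f y))
        + tail_sqr (newton_dir f y)
      <= \sum_i law i * dot (Wf y i *m newton_dir f y) (newton_dir f y)) ->
    ('E_P[fun o => (enorm (wpart (x k o) - wstar) ^+ 2)%R]
     + \sum_(i < n)
       'E_P[fun o => (enorm (apart (x k o) i - grad (f i) wstar) ^+ 2)%R]
     <= C * ((1 - gamma * rho) ^+ k)%:E)%E.
  move=> iid x_init x_step W_eq law0 law1 uW sW W_ge0 stepE rate energy.
  pose V y i := surrogate f y (Wf y i) y.
  have VE y i : V y i = 2^-1 * dot (Wf y i *m newton_dir f y) (newton_dir f y).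
    exact: (surrogate_center n_gt0 f_C2 muf_gt0 f_sc).
  have sumV y : \sum_i law i * V y i = 2^-1 *
      \sum_i law i * dot (Wf y i *m newton_dir f y) (newton_dir f y).
    by rewrite mulr_sumr; apply: eq_bigr => i _; rewrite VE mulrCA.
  rewrite (expectation_trajectory iid x_init x_step k
    (Phi := fun y => enorm (wpart y - wstar) ^+ 2)) => [|s]; last exact: sqr_ge0.
  rewrite (eq_bigr (fun i => (word_mean law k (fun c =>
      enorm (apart (foldl step x0 c) i - grad (f i) wstar) ^+ 2))%:E)); last first.
    move=> i _; rewrite -(expectation_trajectory iid x_init x_step k
      (Phi := fun y => enorm (apart y i - grad (f i) wstar) ^+ 2)) // => s.
    exact: sqr_ge0.
  rewrite sumEFin -EFinD.
  (* Linearity of the finite mean merges the [n + 1] expectations into the mean of [error]. *)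
  have -> : word_mean law k
      (fun c => enorm (wpart (foldl step x0 c) - wstar) ^+ 2)
    + \sum_(i < n) word_mean law k
      (fun c => enorm (apart (foldl step x0 c) i - grad (f i) wstar) ^+ 2)
    = word_mean law k (fun c => error f wstar (foldl step x0 c)).
    rewrite /word_mean exchange_big -big_split; apply: eq_bigr => c _ /=.
    by rewrite -mulr_sumr -mulrDr.
  have CE : C = (c0%:E * 'E_P[fun o => V (x 0%N o) (xi 0%N o)])%E.
    by congr (_ * expectation _ _)%E; apply/funext => o; rewrite W_eq.
  rewrite CE.
  apply: (expected_decay iid x_init x_step (V := V) (gain := gain)) => //.
  - by move=> s i; rewrite VE mulr_ge0 // invr_ge0.
  - exact: ltW.
  - move=> k' o; have [e1 e2] := stepE k' o.
    rewrite x_step; apply: (surrogate_descent n_gt0 muf_gt0 f_C2 f_sc _ _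
      L_gt0 gamma_L e1 e2) => //.
    by move=> z; have := L_bound k' o z; rewrite !W_eq x_step.
  - move=> k' o; rewrite sumV; apply: le_trans (rate k' o).
    by rewrite le_eqVlt; apply/orP; left; apply/eqP; field.
  - move=> s; apply: (error_energy n_gt0 muf_gt0 muf_le_Lf f_C2 f_sc f_lip
      wstar_argmin).
    by rewrite sumV mulrA divff ?mul1r ?energy // pnatr_eq0.
have Wnewton_ge0 y j :
    0 <= dot (Wnewton f y j *m newton_dir f y) (newton_dir f y).
  rewrite Wnewton_form addr_ge0 //.
    apply: le_trans (hess_coercive _ _ (f_sc j) (f_C2 j)).
    by rewrite mulr_ge0 ?dot_ge0 // ltW.
  by apply: sumr_ge0 => i _; exact: dot_ge0.
case: gen => [[x0 [xi [iid x_init x_step W_eq]]]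
             |[x0 [xi [s0 iid x_init x_step W_eq]]]].
- apply: (conclude _ _ _ _ _ (SAN_W f) (SAN_gain f) iid x_init x_step W_eq).
  + by move=> i; rewrite SAN_law_uniform // invr_gt0 ltr0n.
  + under eq_bigr do rewrite SAN_law_uniform //.
    rewrite sumr_const card_option card_ord -[_ *+ _]mulr_natl.
    by rewrite divff // pnatr_eq0.
  + move=> y [j|] /=; [exact: (Wnewton_unit f_C2 muf_gt0 f_sc)|exact: unitmx1].
  + move=> y [j|] /=; [exact: Wnewton_sym|exact: trmx1].
  + move=> y [j|] /=; [exact: Wnewton_ge0|by rewrite mul1mx dot_ge0].
  + move=> k' o /=; split.
      exact: (SAN_step_inner n_gt0 muf_gt0 f_C2 f_sc).
    exact: (SAN_step_sqr muf_gt0 f_C2 f_sc).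
  + move=> k' o; exact: (SAN_rate n_gt0 muf_gt0 muf_le_Lf f_C2 f_sc f_lip).
  + by move=> y; exact: (SAN_energy_ge n_gt0 f_C2 f_sc).
(* The SANA invariant: the [alpha_i] keep their initial zero sum. *)
- have sum0 k' o : \sum_i apart (x k' o) i = 0.
    elim: k' => [|k' IH]; first by rewrite x_init.
    rewrite x_step; exact: SANA_step_sum.
  apply: (conclude _ _ _ _ _ (Wnewton f) (SANA_gain f) iid x_init x_step W_eq).
  + by move=> i; rewrite invr_gt0.
  + by rewrite sumr_const card_ord -[_ *+ _]mulr_natl divff // gt_eqF.
  + exact: (Wnewton_unit f_C2 muf_gt0 f_sc).
  + exact: Wnewton_sym.
  + exact: Wnewton_ge0.
  + move=> k' o /=; split.
      exact: (SANA_step_inner n_gt0 muf_gt0 f_C2 f_sc).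
    exact: (SANA_step_sqr n_gt0 muf_gt0 f_C2 f_sc).
  + move=> k' o; exact: (SANA_rate n_gt0 muf_gt0 muf_le_Lf f_C2 f_sc f_lip).
  + exact: (SANA_energy_ge n_gt0 f_C2 f_sc).
Qed.
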